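(* Let $f:\mathcal X\times\mathcal Y\to\mathbb R$ be continuously differentiable. Let $g:\mathcal X\times\mathcal Y\to\mathbb R$ be three times continuously differentiable and a parametric Morse--Bott function, such that for some $L>0$ the map $y\mapsto\partial_yg(x,y)$ is $L$-Lipschitz for every $x\in\mathcal X$, and such that $g(x,y)\to+\infty$ as $\|y\|\to+\infty$ for every $x\in\mathcal X$. Let $\phi$ be the flow selection of $g$. Let $(\mathcal I_M)_{M\ge0}$, $(\varphi_T)_{T\ge0}$ be maps satisfying Assumption (A) of the context, let $M,T\ge0$ be integers with $T+M>0$, and let $(x_k,y_k,z_k)_{k\ge0}$ be produced by the corrected BGS-Opt algorithm with warm-start described in the context. If $(x_k,y_k,z_k)_{k\ge0}$ converges to a limit point $(x^\star,y^\star,z^\star)$, then $y^\star$ is a critical point of $y\mapsto g(x^\star,y)$. If, in addition, $y^\star$ is a local minimizer of $y\mapsto g(x^\star,y)$, then $$\partial_x\mathcal L_\phi(x^\star,y^\star)=0\quad\text{and}\quad\partial_y g(x^\star,y^\star)=0 .$$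
   Context: $\mathcal X=\mathbb R^p$, $\mathcal Y=\mathbb R^d$ with $p,d$ positive integers. Matrix convention: for a map $\varphi:\mathcal X\times\mathcal Y\to\mathcal Y$, $\partial_x\varphi$ ($p\times d$) and $\partial_y\varphi$ ($d\times d$) are transposed Jacobians; $\partial^2_{xy}g$ is the $p\times d$ matrix with entries $\partial^2g/\partial x_i\partial y_j$. Parametric Morse--Bott: with $\mathcal M:=\{(x,y):\partial_y g(x,y)=0\}$, for every $(x_0,y_0)\in\mathcal M$ there is an open neighborhood $\mathcal V$ of $(x_0,y_0)$ such that $\mathcal M\cap\mathcal V$ is a connected $C^2$ sub-manifold of $\mathcal X\times\mathcal Y$ of dimension $\dim(\mathcal X)+\dim\mathrm{Ker}(\partial^2_{yy}g(x_0,y_0))$. Flow selection: $\phi(x,y):=\lim_{t\to+\infty}\phi_t(x,y)$, where $\frac{d}{dt}\phi_t(x,y)=-\partial_y g(x,\phi_t(x,y))$, $\phi_0(x,y)=y$ (the limit exists under the stated assumptions on $g$). Define $\mathcal L_\phi(x,y):=f(x,\phi(x,y))$ and $\mathcal L_T(x,y):=f(x,\varphi_T(x,y))$. Assumption (A): for all integers $M,T\ge0$, $\mathcal I_M$ and $\varphi_T$ are continuous maps $\mathcal X\times\mathcal Y\to\mathcal Y$ with $\varphi_T$ continuously differentiable (by convention $\varphi_0(x,y)=\mathcal I_0(x,y)=y$). For every $(x,y)$ with $\partial_y g(x,y)=0$ and all $M,T\ge0$ there is a $d\times d$ matrix $D$ such that $\mathcal I_M(x,y)=\varphi_T(x,y)=y$,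 $\partial_x\varphi_T(x,y)=\partial^2_{xy}g(x,y)D$, $\partial_y\varphi_T(x,y)=I+\partial^2_{yy}g(x,y)D$. Finally, for every $(x,y)$ and $M,T\ge0$ with $T+M>0$, the equality $y=\varphi_T(x,\mathcal I_M(x,y))$ implies $\partial_y g(x,y)=0$. Least-squares map: $\mathcal P:(A,v,z)\mapsto\mathcal P(A,v,z)\in\mathbb R^d$ is a continuous map ($A$ a symmetric $d\times d$ matrix, $v,z\in\mathbb R^d$) whose only fixed points in $z$ are exact least-squares solutions: $z=\mathcal P(A,v,z)$ implies $z\in\arg\min_{z'}\|A^2z'+v\|^2$. Corrected BGS-Opt algorithm with warm-start: given $(x_0,y_0,z_0)\in\mathcal X\times\mathcal Y\times\mathbb R^d$ and step-size $\gamma>0$, for $k\ge1$ set $\tilde y_k=\mathcal I_M(x_{k-1},y_{k-1})$, $y_k=\varphi_T(x_{k-1},\tilde y_k)$, $v_k=\partial_y\mathcal L_T(x_{k-1},\tilde y_k)$, $A_k=\partial^2_{yy}g(x_{k-1},y_k)$, $z_k=\mathcal P(A_k,v_k,z_{k-1})$, $\xi_k=A_kz_k$, $d_k=\partial_x\mathcal L_T(x_{k-1},\tilde y_k)+\partial^2_{xy}g(x_{k-1},y_k)\,\xi_k$, and $x_k=x_{k-1}-\gamma d_k$. *)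

(* Defs.v *)
From HB Require Import structures.
From mathcomp Require Import all_boot all_order all_algebra.
From mathcomp Require Import all_classical all_reals all_analysis.

Set Implicit Arguments.
Unset Strict Implicit.
Unset Printing Implicit Defensive.

Import Order.TTheory GRing.Theory Num.Theory.
Import numFieldNormedType.Exports.

Local Open Scope classical_set_scope.
Local Open Scope ring_scope.

(* The library norm on matrices is the sup norm; this is the Euclidean one. *)
Definition enorm (R : realType) (n : nat) (u : 'cV[R]_n) : R :=
  Num.sqrt (\sum_(i < n) u i 0 ^+ 2).

(* [f] is k times continuously differentiable on [U]; meant for [U] open and
   finite-dimensional spaces. The values of [f] outside [U] are irrelevant. *)
Fixpoint Ck_on (R : realType) (V W : normedModType R) (U : set V) (k : nat)
    (f : V -> W) : Prop :=
  match k with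
  | 0 => forall a, U a -> {for a, continuous f}
  | k'.+1 => (forall a, U a -> differentiable f a) /\
             (forall v : V, Ck_on U k' (fun a => 'D_v f a))
  end.

Notation Ck := (Ck_on setT).

Section Derivatives.
Variables (R : realType) (p d : nat).
Local Notation X := 'cV[R]_p.
Local Notation Y := 'cV[R]_d.

Definition gradx (h : X * Y -> R) (w : X * Y) : 'cV[R]_p :=
  \col_(i < p) 'D_((delta_mx i 0 : X), (0 : Y)) h w.

Definition grady (h : X * Y -> R) (w : X * Y) : 'cV[R]_d :=
  \col_(i < d) 'D_((0 : X), (delta_mx i 0 : Y)) h w.

(* Transposed Jacobians: entry (i, j) differentiates the j-th component of the
   map with respect to the i-th variable. *)
Definition jacx (s : X * Y -> Y) (w : X * Y) : 'M[R]_(p, d) :=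
  \matrix_(i < p, j < d) gradx (fun w' => s w' j 0) w i 0.

Definition jacy (s : X * Y -> Y) (w : X * Y) : 'M[R]_d :=
  \matrix_(i < d, j < d) grady (fun w' => s w' j 0) w i 0.

Definition hessxy (g : X * Y -> R) : X * Y -> 'M[R]_(p, d) := jacx (grady g).
Definition hessyy (g : X * Y -> R) : X * Y -> 'M[R]_d := jacy (grady g).

End Derivatives.

(* Embedded C^2 submanifold of dimension [k] of an [n]-dimensional space [E]:
   around each of its points, a C^2 diffeomorphism [psi] (with inverse [psi'])
   from an open set [U] onto an open set of R^n flattens it onto
   R^k x {0}. *)
Definition C2_submanifold (R : realType) (E : normedModType R) (n k : nat)
    (S : set E) : Prop :=
  (k <= n)%N /\
  forall s, S s ->
  exists (U : set E) (W : set 'cV[R]_n) (psi : E -> 'cV[R]_n)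
         (psi' : 'cV[R]_n -> E),
    [/\ open U, U s, open W & psi @` U = W] /\
    [/\ Ck_on U 2 psi, Ck_on W 2 psi',
        (forall e, U e -> psi' (psi e) = e) &
        (forall e, U e ->
           (S e <-> forall i : 'I_n, (k <= i)%N -> psi e i 0 = 0))].

Section Bilevel.
Variables (R : realType) (p d : nat).
Local Notation X := 'cV[R]_p.
Local Notation Y := 'cV[R]_d.

(* [cokermx H] spans, by columns, the kernel of the map v |-> H v. *)
Definition parametric_Morse_Bott (g : X * Y -> R) : Prop :=
  let M := [set w | grady g w = 0] in
  forall w0, M w0 ->
  exists V : set (X * Y)%type,
    [/\ open V, V w0, connected (M `&` V) &
        C2_submanifold (p + d) (p + \rank (cokermx (hessyy g w0)))%N
          (M `&` V)].

(* [flow t (x, y)] solves the gradient-flow equation on [0, +oo[; its values at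
   negative times are irrelevant. *)
Definition gradient_flow (g : X * Y -> R) (flow : R -> X * Y -> Y) : Prop :=
  forall (x : X) (y : Y),
    [/\ flow 0 (x, y) = y,
        {within `[0, +oo[, continuous (fun t : R => flow t (x, y))} &
        (forall t : R, 0 < t ->
           is_derive t 1 (fun s : R => flow s (x, y))
             (- grady g (x, flow t (x, y))))].

Definition flow_selection (flow : R -> X * Y -> Y) (w : X * Y) : Y :=
  lim (flow t w @[t --> +oo]).

Definition composed (f : X * Y -> R) (s : X * Y -> Y) (w : X * Y) : R :=
  f (w.1, s w).

Definition assumption_A (g : X * Y -> R) (I phiT : nat -> X * Y -> Y) : Prop :=
  [/\ (forall M, continuous (I M)),
      (forall T, Ck 1 (phiT T)),
      (forall x y, I 0%N (x, y) = y /\ phiT 0%N (x, y) = y),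
      (forall x y, grady g (x, y) = 0 -> forall M T : nat,
         exists D : 'M[R]_d,
           [/\ I M (x, y) = y, phiT T (x, y) = y,
               jacx (phiT T) (x, y) = hessxy g (x, y) *m D &
               jacy (phiT T) (x, y) = 1%:M + hessyy g (x, y) *m D]) &
      (forall x y (M T : nat), (0 < T + M)%N ->
         y = phiT T (x, I M (x, y)) -> grady g (x, y) = 0)].

(* Only the values of [P] at symmetric matrices [A] are constrained. *)
Definition least_squares_map (P : 'M[R]_d * Y * Y -> Y) : Prop :=
  {within [set a : 'M[R]_d * Y * Y | a.1.1^T = a.1.1], continuous P} /\
  forall (A : 'M[R]_d) (v z : Y), A^T = A -> z = P (A, v, z) ->
    forall z' : Y,
      enorm (A *m A *m z + v) ^+ 2 <= enorm (A *m A *m z' + v) ^+ 2.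

(* [IM] and [phi] are the maps I_M and varphi_T for the chosen M and T. *)
Definition bgs_opt (f g : X * Y -> R) (IM phi : X * Y -> Y)
    (P : 'M[R]_d * Y * Y -> Y) (gamma : R)
    (x : nat -> X) (y z : nat -> Y) : Prop :=
  forall k : nat,
    let yt := IM (x k, y k) in
    let v := grady (composed f phi) (x k, yt) in
    let A := hessyy g (x k, y k.+1) in
    let xi := A *m z k.+1 in
    let dk := gradx (composed f phi) (x k, yt)
              + hessxy g (x k, y k.+1) *m xi in
    [/\ y k.+1 = phi (x k, yt),
        z k.+1 = P (A, v, z k) &
        x k.+1 = x k - gamma *: dk].

End Bilevel.

(* Main.v *)
Require Import Defs.
From HB Require Import structures.
From mathcomp Require Import all_boot all_order all_algebra.
From mathcomp Require Import all_classical all_reals all_analysis.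
From mathcomp Require Import ring lra.
Set Implicit Arguments.
Unset Strict Implicit.
Unset Printing Implicit Defensive.
Import Order.TTheory GRing.Theory Num.Theory.
Import numFieldNormedType.Exports.
Local Open Scope classical_set_scope.
Local Open Scope ring_scope.

(** Write G for the partial gradient of g in y, w for the limit point (x, y) and
A, B for the blocks of second derivatives of g at w, so that G has derivative
(h, k) |-> B^T h + A k at w; A is symmetric by Schwarz's theorem
([second_derivative_comm]).

Passing to the limit in the recursion ([bgs_limit]) makes y a fixed point of
phi_T after I_M, hence G(w) = 0; it makes z a fixed point of the least-squares
map, hence A (A^2 z + v) = 0; and it makes the limit of the directions d_k zero.
With the Jacobians of phi_T prescribed at critical points, these say that some
eta satisfies A (A eta + f_y) = 0 and f_x + B eta = 0, where f_x and f_y are the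
partial gradients of f at w. It remains to differentiate the flow selection.

Geometry ([morse_bott_local]). In a chart that flattens the critical set, G
vanishes on a coordinate subspace whose dimension exceeds that of x by dim Ker A.
Counting ranks, the derivative of G has the same rank as A. So the rows of B lie
in the row space of A, and |G| controls the distance to the subspace. Therefore,
if P0 A = 0, the part P0 G is negligible with respect to G near w.

Dynamics ([flow_limit], [flow_selection_expansion]). At a local minimizer A is
positive semidefinite, and G stays almost in the range of A, where A is coercive.
Along the flow started at y with parameter x + h, |G|^2 therefore has derivative
at most - 2 c |G|^2: the speed decays exponentially, the trajectory converges,
and its length is O(|h|) because |G| = O(|h|) at the start. The displacement k
then satisfies P0 k = o(h) by the geometric estimate, and B^T h + A k = o(h)
because the end point is critical. With Q A + P0 the identity, k = - Q B^T h +
o(h). So the flow selection has derivative - Q B^T in x.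

Conclusion ([stationarity_algebra]). The gradient of the composed loss is
f_x - B Q^T f_y, and since Q A is the orthogonal projection on the range of A
this is f_x + B eta = 0. *)

(** * Norms and limits of matrices and pairs *)

Section Norms.
Variable R : realType.

Lemma entry_norm_le (m n : nat) (M : 'M[R]_(m, n)) i j : `|M i j| <= `|M|.
Proof. by rewrite [leRHS]mx_normrE; apply: (le_bigmax _ _ (i, j)). Qed.

Lemma mx_norm_le (m n : nat) (M : 'M[R]_(m, n)) (e : R) :
  0 <= e -> (forall i j, `|M i j| <= e) -> `|M| <= e.
Proof.
by move=> e0 Me; rewrite [leLHS]mx_normrE; apply: bigmax_le => // -[i j] _; exact: Me.
Qed.

Lemma cvg_mxP (T : Type) (F : set_system T) {FF : Filter F} (m n : nat)
    (f : T -> 'M[R]_(m, n)) (M : 'M[R]_(m, n)) :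
  (forall i j, f t i j @[t --> F] --> M i j) -> f @ F --> M.
Proof.
move=> h; apply/cvgrPdist_le => e e0.
have : \forall t \near F, forall ij : 'I_m * 'I_n, `|M ij.1 ij.2 - f t ij.1 ij.2| <= e.
  by apply: filter_forall => -[i j] /=; move/cvgrPdist_le: (h i j); apply.
apply: filterS => t ht; apply: mx_norm_le; first exact: ltW.
by move=> i j; rewrite !mxE; exact: (ht (i, j)).
Qed.

Lemma cvg_mx_coord (T : Type) (F : set_system T) {FF : Filter F} (m n : nat)
    (f : T -> 'M[R]_(m, n)) (M : 'M[R]_(m, n)) i j :
  f @ F --> M -> f t i j @[t --> F] --> M i j.
Proof.
move=> fM.
exact: (@cvg_comp _ _ _ f (fun N : 'M[R]_(m, n) => N i j) F _ _ fM
  (@coord_continuous _ _ _ i j M)).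
Qed.

Lemma cvg_mulmx (T : Type) (F : set_system T) {FF : Filter F} (m n q : nat)
    (f : T -> 'M[R]_(m, n)) (g : T -> 'M[R]_(n, q))
    (M : 'M[R]_(m, n)) (N : 'M[R]_(n, q)) :
  f @ F --> M -> g @ F --> N -> f t *m g t @[t --> F] --> M *m N.
Proof.
move=> fM gN; apply: cvg_mxP => i j; rewrite mxE.
under eq_fun do rewrite mxE.
apply: cvg_big => [|k _]; first exact: add_continuous.
apply: cvgM; exact: cvg_mx_coord.
Qed.

(** The summand 1 makes this bound on the operator norm positive, so that one can
divide by it. *)
Definition mxbound (m n : nat) (M : 'M[R]_(m, n)) : R := 1 + n%:R * `|M|.

Lemma mxbound_gt0 (m n : nat) (M : 'M[R]_(m, n)) : 0 < mxbound M.
Proof. by rewrite ltr_wpDr// mulr_ge0. Qed.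

Lemma mulmx_norm_le_dim (m n : nat) (M : 'M[R]_(m, n)) (v : 'cV[R]_n) :
  `|M *m v| <= n%:R * `|M| * `|v|.
Proof.
apply: mx_norm_le => [|i j]; first by rewrite !mulr_ge0.
rewrite mxE (le_trans (ler_norm_sum _ _ _))//.
apply: (@le_trans _ _ (\sum_(k < n) `|M| * `|v|)).
  by apply: ler_sum => k _; rewrite normrM ler_pM// entry_norm_le.
by rewrite sumr_const card_ord -[leLHS]mulr_natl mulrA.
Qed.

Lemma mulmx_norm_le (m n : nat) (M : 'M[R]_(m, n)) (v : 'cV[R]_n) :
  `|M *m v| <= mxbound M * `|v|.
Proof.
by rewrite (le_trans (mulmx_norm_le_dim _ _))// ler_wpM2r// /mxbound lerDr.
Qed.

Lemma mulmx_continuous (m n : nat)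
  (M : 'M[R]_(m, n)) : continuous (fun v : 'cV[R]_n => M *m v).
Proof. 
by move=> v; apply: (@cvg_mulmx _ (nbhs v) _ _ _ _ (fun=> M) id);
  [exact: cvg_cst|exact: cvg_id].
Qed.

Lemma pair_normE (V W : normedModType R) (a : V) (b : W) :
  `|(a, b)| = Num.max `|a| `|b| :> R.
Proof. by []. Qed.

Lemma fst_norm_le (V W : normedModType R) (u : V * W) : `|u.1| <= `|u|.
Proof. by case: u => a b; rewrite pair_normE le_max lexx. Qed.
Lemma snd_norm_le (V W : normedModType R) (u : V * W) : `|u.2| <= `|u|.
Proof. by case: u => a b; rewrite pair_normE le_max lexx orbT. Qed.

End Norms.

(** * Strict differentiability of C1 maps *)

Section StrictDiff.
Variable R : realType.

(** Comparing two arbitrary nearby points, not only a point with [a], is what C1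
regularity gives beyond differentiability. It lets G be compared at a point and
at a nearby critical point, and it survives composition with a chart. *)
Definition strict_diff (V W : normedModType R) (f : V -> W) (a : V) (L : V -> W) :=
  forall e : R, 0 < e -> exists2 r : R, 0 < r & forall u v : V,
    `|u - a| < r -> `|v - a| < r -> `|f u - f v - L (u - v)| <= e * `|u - v|.

Lemma is_derive_line (V W : normedModType R) (f : V -> W) (v h : V) (t : R) :
  differentiable f (v + t *: h) ->
  is_derive t (1:R) (fun s : R => f (v + s *: h)) ('d f (v + t *: h) h).
Proof.
move=> df.
have dl : is_diff t (fun s : R => v + s *: h) (fun s : R => s *: h).
  have -> : (fun s : R => v + s *: h) = cst v + (fun s : R => s *: h) by [].
  by apply: is_diff_eq; rewrite add0r.
have df2 := differentiableP df.
have dfl : is_diff t (f \o (fun s : R => v + s *: h))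
    ('d f (v + t *: h) \o (fun s : R => s *: h)).
  exact: is_diff_comp.
apply: DeriveDef; first by apply: diff_derivable; case: dfl.
rewrite deriveE; last by case: dfl.
rewrite (_ : (fun s : R => f (v + s *: h)) = f \o (fun s : R => v + s *: h))//.
by rewrite diff_val /= scale1r.
Qed.

(** The mean value theorem on the segment from [v] to [u], which stays in the ball
by convexity. *)
Lemma mean_value_le (V : normedModType R) (f : V -> R) (a : V) (r e : R) (L : V -> R) :
  (forall c, `|c - a| < r -> differentiable f c) ->
  (forall c h, `|c - a| < r -> `|'d f c h - L h| <= e * `|h|) ->
  forall u v, `|u - a| < r -> `|v - a| < r ->
  `|f u - f v - L (u - v)| <= e * `|u - v|.
Proof.
move=> df dL u v ur vr.
have seg (t : R) : 0 <= t <= 1 -> `|v + t *: (u - v) - a| < r.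
  move=> /andP[t0 t1].
  have -> : v + t *: (u - v) - a = (1 - t) *: (v - a) + t *: (u - a).
    have -> : u - v = (u - a) - (v - a) by rewrite opprB addrA subrK.
    by rewrite addrAC (scalerBr t) scalerBl scale1r addrCA addrC.
  apply: (le_lt_trans (ler_normD _ _)); rewrite !normrZ ger0_norm ?subr_ge0// (ger0_norm t0).
  have [->|tn0] := eqVneq t 0; first by rewrite mul0r addr0 subr0 mul1r.
  have tp : 0 < t by rewrite lt_def tn0.
  have := ltr_pM2l tp `|u - a| r; rewrite ur => h1.
  have h2 : (1 - t) * `|v - a| <= (1 - t) * r by rewrite ler_wpM2l ?subr_ge0// ltW.
  rewrite (_ : r = (1 - t) * r + t * r); last by ring.
  by apply: ler_ltD.
pose F (t : R) := f (v + t *: (u - v)).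
have FD (t : R) : 0 <= t <= 1 -> is_derive t (1:R) F ('d f (v + t *: (u - v)) (u - v)).
  by move=> t01; apply: is_derive_line; apply: df; exact: seg.
have [c c01] : exists2 c, c \in `[0, 1]%R & 
    F 1 - F 0 = 'd f (v + c *: (u - v)) (u - v) * (1 - 0).
  apply: (@MVT_segment _ F (fun c => 'd f (v + c *: (u - v)) (u - v))) => //.
    by move=> x; rewrite in_itv /= => /andP[x0 x1]; apply: FD; rewrite !ltW.
  apply: derivable_within_continuous => x; rewrite in_itv /= => x01.
  by have := FD x x01; case.
rewrite /F scale1r scale0r addr0 [v + (u - v)]addrC subrK subr0 mulr1 => ->.
by apply: dL; apply: seg; move: c01; rewrite in_itv.
Qed.

Lemma expansion_diff (V W : normedModType R) (f : V -> W) (a : V) (L : {linear V -> W}) :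
  continuous L ->
  (forall e : R, 0 < e -> exists2 r : R, 0 < r & forall u : V,
    `|u - a| < r -> `|f u - f a - L (u - a)| <= e * `|u - a|) ->
  differentiable f a /\ 'd f a = L :> (V -> W).
Proof.
move=> Lc h.
have E : f \o shift a = cst (f a) + L +o_ (0 : V) id.
  apply/eqaddoP => e e0; have [r r0 rP] := h e e0.
  near=> u; have := rP (u + a); rewrite addrK opprD addrA /=; apply.
  by near: u; apply: nbhs0_lt.
have dE := diff_unique Lc E.
by split=> //; apply/diff_locallyP; rewrite dE.
Unshelve. all: by end_near. Qed.

(** A finite-dimensionality certificate: a spanning family with coordinates bounded
by the norm. It reduces uniform estimates on differentials to finitely many
directional derivatives, both for column vectors and for pairs of them. *)
Definition has_frame (V : normedModType R) :=
  exists (n : nat) (e : 'I_n -> V) (l : 'I_n -> V -> R),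
  forall v, v = \sum_i l i v *: e i /\ forall i, `|l i v| <= `|v|.

(** Continuity of the finitely many partial derivatives makes the differential
continuous in operator norm; the mean value inequality concludes. *)
Lemma C1_strict_diff (V : normedModType R) (f : V -> R) (U : set V) (a : V) :
  has_frame V -> open U -> U a -> Ck_on U 1 f -> strict_diff f a ('d f a).
Proof.
move=> [n [e [l lP]]] oU Ua [fd fc] eps eps0.
have n0 : 0 < eps / n.+1%:R by rewrite divr_gt0.
have /nbhs_normP[r /= r0 rP] : \forall c \near a, U c /\
    forall i, `|'D_(e i) f a - 'D_(e i) f c| <= eps / n.+1%:R.
  near=> c; split; first by near: c; exact: open_nbhs_nbhs.
  near: c; apply: filter_forall => i.
  by move/cvgrPdist_le: (fc (e i) a Ua); apply.
exists r => // u v ur vr.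
apply: (@mean_value_le _ _ a r) => // [c cr|c h cr].
  by apply: fd; case: (rP c); rewrite //= distrC.
have [Uc fac] := rP c ltac:(by rewrite /= distrC).
have expand b : U b -> 'd f b h = \sum_i l i h * 'D_(e i) f b.
  move=> Ub; rewrite [in LHS](proj1 (lP h)) linear_sum; apply: eq_bigr => i _.
  by rewrite linearZ /= deriveE//; exact: fd.
rewrite !expand// -sumrB.
apply: (le_trans (ler_norm_sum _ _ _)).
apply: (@le_trans _ _ (\sum_(i < n) (eps / n.+1%:R * `|h|))).
  apply: ler_sum => i _; rewrite -mulrBr normrM mulrC ler_pM//; last exact: (proj2 (lP h)).
  by rewrite distrC.
rewrite sumr_const card_ord -mulrnAl ler_wpM2r//.
rewrite -[_ *+ n]mulr_natr -mulrA ler_piMr ?(ltW eps0)//.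
by rewrite mulrC ler_pdivrMr// mul1r ler_nat.
Unshelve. all: by end_near. Qed.

Lemma frame_cV n : has_frame 'cV[R]_n.
Proof.
exists n, (fun i => delta_mx i 0), (fun i (v : 'cV[R]_n) => v i 0) => v; split.
  rewrite {1}(matrix_sum_delta v); apply: eq_bigr => i _.
  by rewrite big_ord1.
by move=> i; exact: entry_norm_le.
Qed.

Lemma frame_prod (V W : normedModType R) : 
  has_frame V -> has_frame W -> has_frame (V * W)%type.
Proof.
move=> [n [e [l lP]]] [m [e' [l' lP']]].
exists (n + m)%N, 
  (fun i : 'I_(n + m) =>
     match fintype.split i with inl j => (e j, 0) | inr j => (0, e' j) end),
  (fun (i : 'I_(n + m)) (u : V * W) =>
     match fintype.split i with inl j => l j u.1 | inr j => l' j u.2 end) => u; split.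
  rewrite big_split_ord /=.
  under eq_bigr do rewrite (unsplitK (inl _)).
  under [X in _ + X]eq_bigr do rewrite (unsplitK (inr _)).
  case: u => a b /=.
  have [aE _] := lP a; have [bE _] := lP' b.
  rewrite [in LHS]aE [in LHS]bE.
  rewrite [RHS]surjective_pairing; congr (_, _).
    rewrite (raddfD fst) /= !(raddf_sum fst) /= [X in _ + X]big1 ?addr0// => i _ /=.
    by rewrite scaler0.
  rewrite (raddfD snd) /= !(raddf_sum snd) /= [X in X + _]big1 ?add0r// => i _ /=.
  by rewrite scaler0.
move=> i; case: (fintype.split i) => j.
  by apply: le_trans (fst_norm_le _); exact: (proj2 (lP _)).
by apply: le_trans (snd_norm_le _); exact: (proj2 (lP' _)).
Qed.

Lemma strict_diff_mx (V : normedModType R) (m n : nat) (f : V -> 'M[R]_(m, n)) a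
    (L : V -> 'M[R]_(m, n)) :
  (forall i j, strict_diff (fun v => f v i j) a (fun v => L v i j)) -> strict_diff f a L.
Proof.
move=> h e e0.
pose Q (r : R) := forall ij : 'I_m * 'I_n, forall u v : V,
   `|u - a| < r -> `|v - a| < r ->
    `|f u ij.1 ij.2 - f v ij.1 ij.2 - L (u - v) ij.1 ij.2| <= e * `|u - v|.
have QP : \forall r \near 0^'+, Q r.
  apply: filter_forall => -[i j] /=; have [r r0 rP] := h i j e e0.
  near=> s => u v us vs.
  have sr : s < r by near: s; exact: nbhs_right_lt.
  by apply: rP; [exact: (lt_trans us)|exact: (lt_trans vs)].
near (0:R)^'+ => r.
exists r => [//|u v ur vr]; apply: mx_norm_le => [|i j]; first by rewrite mulr_ge0// ltW.
have Qr : Q r by near: r; exact: QP.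
by rewrite !mxE; exact: (Qr (i, j) u v ur vr).
Unshelve. all: by end_near. Qed.

Lemma strict_diff_pair (V W W' : normedModType R) (f : V -> W * W') a L :
  strict_diff (fun v => (f v).1) a (fun v => (L v).1) ->
  strict_diff (fun v => (f v).2) a (fun v => (L v).2) -> strict_diff f a L.
Proof.
move=> h1 h2 e e0.
have [r1 r10 r1P] := h1 e e0; have [r2 r20 r2P] := h2 e e0.
exists (Num.min r1 r2) => [|u v]; first by rewrite lt_min r10.
rewrite !lt_min => /andP[u1 u2] /andP[v1 v2].
move: (r1P u v u1 v1) (r2P u v u2 v2).
by case: (f u) (f v) (L (u - v)) => [? ?] [? ?] [? ?] /= A B; rewrite pair_normE ge_max A.
Qed.

Lemma strict_diff_lipschitz (V W : normedModType R) (f : V -> W) a L :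
  strict_diff f a L -> (exists2 C, 0 < C & forall v, `|L v| <= C * `|v|) ->
  exists2 C, 0 < C & exists2 r : R, 0 < r & forall u v,
     `|u - a| < r -> `|v - a| < r -> `|f u - f v| <= C * `|u - v|.
Proof.
move=> h [C C0 CP].
have [r r0 rP] := h 1 ltr01.
exists (1 + C); first by rewrite addr_gt0.
exists r => // u v ur vr.
rewrite -[f u - f v](subrK (L (u - v))) (le_trans (ler_normD _ _))// mulrDl lerD//.
exact: rP.
Qed.

Lemma strict_diff_comp (V W Z : normedModType R) (f : V -> W) (g : W -> Z) a L M :
  (forall v w, M (v - w) = M v - M w) ->
  (exists2 C, 0 < C & forall v, `|L v| <= C * `|v|) ->
  (exists2 C, 0 < C & forall v, `|M v| <= C * `|v|) ->
  strict_diff f a L -> strict_diff g (f a) M -> strict_diff (g \o f) a (M \o L).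
Proof.
move=> MB LC [CM CM0 CMP] sf sg e e0.
have [C C0 [r0 r00 rlip]] := strict_diff_lipschitz sf LC.
have [r1 r10 r1P] := sg (e / 2 / C) ltac:(by rewrite !divr_gt0).
have [r2 r20 r2P] := sf (e / 2 / CM) ltac:(by rewrite !divr_gt0).
pose r := Num.min (Num.min r0 r2) (r1 / C).
exists r; first by rewrite !lt_min r00 r20 divr_gt0.
move=> u v; rewrite !lt_min => /andP[/andP[ur0 ur2] ur1] /andP[/andP[vr0 vr2] vr1].
have fa w : `|w - a| < r0 -> `|w - a| < r1 / C -> `|f w - f a| < r1.
  move=> w0 w1; apply: le_lt_trans (rlip w a w0 _) _; first by rewrite subrr normr0.
  by rewrite mulrC -ltr_pdivlMr.
have E1 := r1P (f u) (f v) (fa u ur0 ur1) (fa v vr0 vr1).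
have E2 := r2P u v ur2 vr2.
have E3 := rlip u v ur0 vr0.
have -> : (g \o f) u - (g \o f) v - (M \o L) (u - v) =
  (g (f u) - g (f v) - M (f u - f v)) + M (f u - f v - L (u - v)).
  by rewrite (MB _ (L _)) addrA subrK.
apply: (le_trans (ler_normD _ _)); rewrite [e in leRHS]splitr mulrDl lerD//.
  apply: (le_trans E1); rewrite -mulrA ler_wpM2l ?divr_ge0 ?(ltW e0)//.
  by rewrite mulrC ler_pdivrMr// mulrC.
apply: (le_trans (CMP _)).
by rewrite mulrC -ler_pdivlMr// (le_trans E2)// mulrAC.
Qed.

End StrictDiff.

(** * Projections, ranks and symmetry of second derivatives *)

Section LinAlg.
Variable R : realType.

Lemma dot_self_eq0 (d : nat) (v : 'rV[R]_d) : v *m v^T = 0 -> v = 0.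
Proof.
move=> /matrixP /(_ 0 0); rewrite !mxE => /eqP.
rewrite psumr_eq0 => [/allP v0|i _]; last by rewrite mxE -expr2 sqr_ge0.
apply/rowP => i; rewrite mxE; apply/eqP.
by have := v0 i (mem_index_enum _); rewrite mxE mulf_eq0 orbb.
Qed.

(** For a real symmetric matrix, the kernel meets the range trivially, so A^2 and A
have the same row space. Any such [Q] makes [Q *m A] the orthogonal projection on
the range of [A]. *)
Lemma sym_factor_sq (d : nat) (A : 'M[R]_d) : A^T = A ->
  exists Q : 'M[R]_d, A = Q *m A *m A.
Proof.
move=> sA.
have rk : \rank (A *m A) = \rank A.
  rewrite -[RHS](mxrank_mul_ker A A) [X in (_ + X)%N](_ : _ = 0%N) ?addn0//.
  apply/eqP; rewrite mxrank_eq0 -submx0; apply/row_subP => i.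
  move: (row_sub i (A :&: kermx A)%MS); rewrite sub_capmx => /andP[/submxP[D vD] /sub_kermxP vA].
  rewrite (dot_self_eq0 (v := row i (A :&: kermx A)%MS)) ?sub0mx//.
  by rewrite {2}vD trmx_mul sA mulmxA vA mul0mx.
have /mxrank_leqif_eq [_ /esym] := submxMl A A.
rewrite rk eqxx => /andP[_ /submxP[Q AQ]].
by exists Q; rewrite -mulmxA.
Qed.

(** Here [N] is the derivative of G read in a chart with inverse derivative [Psi'],
and the critical set is flattened onto the first [k] coordinates, which [N]
therefore kills. Then rank N <= rank A, whereas the derivative of G contains the
block [A] and has the rank of [N]. Equality of the ranks gives both conclusions:
the rows of [B] are combinations of those of [A], and [N] is injective on the
last coordinates. *)
Lemma chart_rank (p d : nat) (B : 'M[R]_(p, d)) (A : 'M[R]_d) (Psi' Psi : 'M[R]_(p + d)) :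
  let k := (p + \rank (cokermx A))%N in
  let N := (col_mx B A)^T *m Psi' in
  Psi' *m Psi = 1%:M -> N *m (pid_mx k : 'M[R]_(p + d)) = 0 ->
  (B <= A)%MS /\ exists Q : 'M[R]_(p + d, d), copid_mx k = Q *m N.
Proof.
move=> k N Psi1 Nk.
have rA : (\rank A <= d)%N by exact: rank_leq_row.
have nk : (p + d - k = \rank A)%N by rewrite /k mxrank_coker subnDl subKn.
have kn : (k <= p + d)%N by rewrite /k mxrank_coker leq_add2l leq_subr.
have NS : \rank N = \rank (col_mx B A).
  rewrite mxrankMfree ?mxrank_tr// row_free_unit.
  by case: (mulmx1_unit Psi1).
have Nker : (N <= kermx (pid_mx k : 'M[R]_(p + d)))%MS by apply/sub_kermxP.
have rker : \rank (kermx (pid_mx k : 'M[R]_(p + d))) = \rank A.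
  by rewrite mxrank_ker rank_pid_mx// nk.
have AS : (A <= col_mx B A)%MS by rewrite -addsmxE addsmxSr.
have rS : \rank (col_mx B A) = \rank A.
  by apply/eqP; rewrite eqn_leq -{1}NS -{1}rker !mxrankS.
have /mxrank_leqif_eq [_ /esym] := AS.
rewrite rS eqxx => /andP[_ SA]; split.
  by apply: submx_trans SA; rewrite -addsmxE addsmxSl.
have /mxrank_leqif_eq [_ /esym] := Nker.
rewrite NS rS rker eqxx => /andP[_ kerN].
apply/submxP; apply: submx_trans kerN; apply/sub_kermxP.
by rewrite mul_copid_mx_pid.
Qed.

End LinAlg.

Section CkTheory.
Variable R : realType.

Lemma Ck_cont (V W : normedModType R) (U : set V) k (f : V -> W) a :
  Ck_on U k f -> U a -> {for a, continuous f}.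
Proof.
by case: k => [fc Ua|k [fd _] Ua]; [exact: fc|apply: differentiable_continuous; exact: fd].
Qed.

Lemma Ck_pred (V W : normedModType R) (U : set V) k (f : V -> W) :
  Ck_on U k.+1 f -> Ck_on U k f.
Proof.
elim: k f => [|k IH] f fk; first by move=> a; exact: Ck_cont fk.
by case: fk => fd fc; split=> // v; apply: IH; exact: fc.
Qed.

Lemma Ck_C1 (V W : normedModType R) (U : set V) k (f : V -> W) :
  Ck_on U k.+1 f -> Ck_on U 1 f.
Proof. by move=> [fd fc]; split=> // v a Ua; exact: (Ck_cont (fc v) Ua). Qed.

(** Apply the mean value theorem in the direction [u], then strict differentiability
of the first derivative in the direction [v]. *)
Lemma second_difference (V : normedModType R) (f : V -> R) (a u v : V) :
  has_frame V -> Ck 2 f -> forall e : R, 0 < e -> \forall t \near (0:R)^'+,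
   `|f (a + t *: v + t *: u) - f (a + t *: u) - (f (a + t *: v) - f a)
      - t ^+ 2 * 'D_v ('D_u f) a| <= e * t ^+ 2.
Proof.
move=> fV [fd fC1] e e0.
have sD := C1_strict_diff fV (@openT V) (I : setT a) (fC1 u).
have [r r0 rP] := sD (e / (1 + `|v|)) (divr_gt0 e0 (ltr_wpDr (normr_ge0 v) ltr01)).
near=> t.
have t0 : 0 < t by [].
have tr : t * (1 + `|u| + `|v|) < r.
  have s0 : 0 < 1 + `|u| + `|v| by rewrite -addrA ltr_wpDr// addr_ge0.
  by rewrite -ltr_pdivlMr//; near: t; apply: nbhs_right_lt; rewrite divr_gt0.
pose F (s : R) := f ((a + t *: v) + s *: (t *: u)) - f (a + s *: (t *: u)).
pose dF (s : R) := 'd f ((a + t *: v) + s *: (t *: u)) (t *: u)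
  - 'd f (a + s *: (t *: u)) (t *: u).
have FD (s : R) : is_derive s (1:R) F (dF s).
  by apply: is_deriveB; apply: is_derive_line; exact: fd.
have [c c01 Fc] : exists2 c, c \in `[0, 1]%R & F 1 - F 0 = dF c * (1 - 0).
  apply: MVT_segment => //; apply: derivable_within_continuous => s _.
  by have [] := FD s.
move: Fc; rewrite /F /dF !scale1r !scale0r !addr0 subr0 mulr1 => ->.
have [c0 c1] : 0 <= c /\ c <= 1 by move: c01; rewrite in_itv /= => /andP.
pose q := a + c *: (t *: u).
have -> : a + t *: v + c *: (t *: u) = q + t *: v by rewrite /q addrAC.
have lin b : 'd f b (t *: u) = t * 'D_u f b by rewrite linearZ deriveE//; exact: fd.
rewrite !lin -/q.
have qa : `|q - a| <= t * `|u|.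
  by rewrite /q addrAC subrr add0r !normrZ (ger0_norm c0) (gtr0_norm t0) ler_piMl// mulr_ge0// ltW.
have qtv : `|t *: v| = t * `|v| by rewrite normrZ gtr0_norm.
have q1 : `|q + t *: v - a| < r.
  rewrite addrAC (le_lt_trans (ler_normD _ _))// qtv (le_lt_trans _ tr)//.
  by rewrite !mulrDr lerD// ler_wpDl// mulr1 ltW.
have q2 : `|q - a| < r.
  rewrite (le_lt_trans _ tr)// (le_trans qa)// !mulrDr mulr1.
  have : 0 <= t * `|v| by rewrite mulr_ge0// ltW.
  lra.
have := rP _ _ q1 q2.
have -> : q + t *: v - q = t *: v by rewrite addrAC subrr add0r.
have -> : 'd ('D_u f) a (t *: v) = t * 'D_v ('D_u f) a.
  by rewrite linearZ /= deriveE//; case: (fC1 u) => + _; apply.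
rewrite qtv => H.
rewrite expr2 -mulrA -!mulrBr normrM gtr0_norm// mulrCA ler_wpM2l ?(ltW t0)//.
apply: (le_trans H); rewrite mulrCA mulrC ler_wpM2r ?(ltW t0)//.
by rewrite -mulrA ler_piMr ?(ltW e0)// mulrC ler_pdivrMr ?mul1r ?lerDr// ltr_wpDr.
Unshelve. all: by end_near. Qed.

Fact close_of_close_expansions (a1 a2 a3 a4 x y e s : R) : 0 < s ->
  `|a1 - a2 - (a3 - a4) - s * x| <= e / 2 * s ->
  `|a1 - a3 - (a2 - a4) - s * y| <= e / 2 * s -> `|x - y| <= e.
Proof.
move=> s0.
have -> : (`|x - y| <= e) = (`|(x - y) * s| <= e * s).
  by rewrite normrM (gtr0_norm s0) ler_pM2r.
by rewrite !ler_norml => /andP[h1 h2] /andP[h3 h4]; apply/andP; split; lra.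
Qed.

(** The second difference of [f] over the parallelogram spanned by [t *: u] and
[t *: v] is symmetric in [u] and [v]. *)
Lemma second_derivative_comm (V : normedModType R) (f : V -> R) (a u v : V) :
  has_frame V -> Ck 2 f -> 'D_v ('D_u f) a = 'D_u ('D_v f) a.
Proof.
move=> fV f2; apply/eqP; rewrite -subr_eq0 -normr_le0; apply/ler_addgt0Pl => e e0.
rewrite addr0.
have e2 : 0 < e / 2 by rewrite divr_gt0.
have S1 := second_difference a u v fV f2 e2.
have S2 := second_difference a v u fV f2 e2.
have S0 : \forall t \near (0:R)^'+, 0 < t by exact: nbhs_right_gt.
have [t [[H1 H2] tp]] := filter_ex (filterI (filterI S1 S2) S0).
have t0 : 0 < t ^+ 2 by rewrite exprn_gt0.
rewrite [a + t *: u + t *: v]addrAC in H2.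
exact: (close_of_close_expansions t0 H1 H2).
Qed.

End CkTheory.

(** * Coordinates, gradients and Jacobians *)

Section Coordinates.
Variable R : realType.

Lemma diff_lin_comp (V W W' : normedModType R) (f : V -> W) (c : {linear W -> W'}) (a v : V) :
  continuous c -> differentiable f a ->
  differentiable (c \o f) a /\ 'd (c \o f) a v = c ('d f a v).
Proof.
move=> cc fd; have cd := linear_differentiable (f a) cc.
by split; [exact: differentiable_comp|rewrite diff_comp//= diff_lin].
Qed.

(** On [U] the derivative of [c \o f] is the image under [c] of that of [f]; the two
may differ outside, hence the openness of [U]. *)
Lemma Ck1_lin (V W W' : normedModType R) (U : set V) (f : V -> W) (c : {linear W -> W'}) :
  open U -> continuous c -> Ck_on U 1 f -> Ck_on U 1 (c \o f).
Proof.
move=> oU cc [fd fc].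
split=> [a Ua|v a Ua].
  by have [] := diff_lin_comp a cc (fd a Ua).
have E b : U b -> 'D_v (c \o f) b = c ('D_v f b).
  by move=> /fd fb; have [cfb] := diff_lin_comp v cc fb; rewrite !deriveE.
rewrite /prop_for /continuous_at E//.
have: (c \o (fun b => 'D_v f b)) b @[b --> a] --> c ('D_v f a).
  exact: (@cvg_comp _ _ _ (fun b => 'D_v f b) c (nbhs a) _ _ (fc v a Ua) (cc _)).
apply: cvg_trans; apply: near_eq_cvg; near=> b; rewrite /= E//.
by near: b; exact: open_nbhs_nbhs.
Unshelve. all: by end_near. Qed.

Lemma coord_linear m n (i : 'I_m) (j : 'I_n) :
  exists c : {linear 'M[R]_(m, n) -> R}, (fun N : 'M[R]_(m, n) => N i j) = c.
Proof.
have lin : linear (fun N : 'M[R]_(m, n) => N i j : R) by move=> a u v; rewrite !mxE.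
by exists (HB.pack (fun N : 'M[R]_(m, n) => N i j : R)
  (GRing.isLinear.Build _ _ _ _ _ lin) : {linear _ -> _}).
Qed.

Lemma Ck1_coord (V : normedModType R) (U : set V) m n (f : V -> 'M[R]_(m, n)) i j :
  open U -> Ck_on U 1 f -> Ck_on U 1 (fun v => f v i j).
Proof.
move=> oU f1; have [c cE] := coord_linear i j.
have cc : continuous c by rewrite -cE; exact: coord_continuous.
by have := Ck1_lin oU cc f1; rewrite -cE.
Qed.

Lemma diff_coord (V : normedModType R) m n (f : V -> 'M[R]_(m, n)) (a v : V) i j :
  differentiable f a ->
  differentiable (fun b => f b i j) a /\ 'd (fun b => f b i j) a v = 'd f a v i j.
Proof.
move=> fd; have [c cE] := coord_linear i j.
have cc : continuous c by rewrite -cE; exact: coord_continuous.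
by have := diff_lin_comp v cc fd; rewrite -cE.
Qed.

Lemma Ck1_pair (V W W' : normedModType R) (U : set V) (f : V -> W * W') :
  open U -> Ck_on U 1 f -> Ck_on U 1 (fun v => (f v).1) /\ Ck_on U 1 (fun v => (f v).2).
Proof.
move=> oU f1; split.
  by apply: (@Ck1_lin _ _ _ U f (fst : {linear _ -> _}) oU) => // x; exact: cvg_fst.
by apply: (@Ck1_lin _ _ _ U f (snd : {linear _ -> _}) oU) => // x; exact: cvg_snd.
Qed.

Lemma diff_pair_components (V W W' : normedModType R) (f : V -> W * W') a v :
  differentiable f a ->
  'd (fun b => (f b).1) a v = ('d f a v).1 /\ 'd (fun b => (f b).2) a v = ('d f a v).2.
Proof.
move=> fd; split.
  have cf : continuous (fst : W * W' -> W) by move=> x; exact: cvg_fst.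
  by have [] := @diff_lin_comp _ _ _ f (fst : {linear _ -> _}) a v cf fd.
have cf : continuous (snd : W * W' -> W') by move=> x; exact: cvg_snd.
by have [] := @diff_lin_comp _ _ _ f (snd : {linear _ -> _}) a v cf fd.
Qed.

End Coordinates.

Section Gradients.
Variables (R : realType) (p d : nat).
Local Notation X := 'cV[R]_p.
Local Notation Y := 'cV[R]_d.

Lemma cV_basis (n : nat) (v : 'cV[R]_n) : v = \sum_i v i 0 *: delta_mx i 0.
Proof.
by rewrite [LHS]matrix_sum_delta; apply: eq_bigr => i _; rewrite big_ord1.
Qed.

Lemma diff_gradients (h : X * Y -> R) w (u : X * Y) : differentiable h w ->
  'd h w u = \sum_i gradx h w i 0 * u.1 i 0 + \sum_i grady h w i 0 * u.2 i 0.
Proof.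
move=> hd; case: u => a b /=.
have -> : (a, b) = \sum_i a i 0 *: ((delta_mx i 0 : X), (0 : Y))
    + \sum_i b i 0 *: ((0 : X), (delta_mx i 0 : Y)).
  rewrite [RHS]surjective_pairing; congr (_, _).
    rewrite (raddfD fst) /= !(raddf_sum fst) /= [X in _ + X]big1 ?addr0; first exact: cV_basis.
    by move=> i _ /=; rewrite scaler0.
  rewrite (raddfD snd) /= !(raddf_sum snd) /= [X in X + _]big1 ?add0r; first exact: cV_basis.
  by move=> i _ /=; rewrite scaler0.
rewrite linearD !linear_sum; congr (_ + _); apply: eq_bigr => i _; rewrite linearZ mxE deriveE//=;
  exact: mulrC.
Qed.

Lemma C1_grad_cont (h : X * Y -> R) : Ck 1 h -> continuous (gradx h) /\ continuous (grady h).
Proof.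
move=> [hd hc]; split=> w; apply: cvg_mxP => i j; rewrite mxE;
  under eq_fun do rewrite mxE; exact: hc.
Qed.

Lemma C1_jac_cont (s : X * Y -> Y) : (forall j, Ck 1 (fun w => s w j 0)) ->
  continuous (jacx s) /\ continuous (jacy s).
Proof.
move=> s1; split=> w; apply: cvg_mxP => i j; rewrite mxE;
  under eq_fun do rewrite mxE; apply: cvg_mx_coord.
  by case: (C1_grad_cont (s1 j)) => + _; apply.
by case: (C1_grad_cont (s1 j)) => _; apply.
Qed.

(** The differential of [s] expressed through transposed Jacobians. *)
Definition jac_map (s : X * Y -> Y) (w u : X * Y) : Y :=
  (jacx s w)^T *m u.1 + (jacy s w)^T *m u.2.

Lemma jac_mapE (s : X * Y -> Y) w u j : differentiable (fun w' => s w' j 0) w ->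
  jac_map s w u j 0 = 'd (fun w' => s w' j 0) w u.
Proof.
move=> sd; rewrite diff_gradients// !mxE; congr (_ + _); apply: eq_bigr => i _;
  by rewrite !mxE.
Qed.

Lemma jac_mapB s w u v : jac_map s w (u - v) = jac_map s w u - jac_map s w v.
Proof. by rewrite /jac_map/= !mulmxBr opprD addrACA. Qed.

Lemma jac_map_bound s w : exists2 C, 0 < C & forall u, `|jac_map s w u| <= C * `|u|.
Proof.
exists (mxbound (jacx s w)^T + mxbound (jacy s w)^T).
  by rewrite addr_gt0// mxbound_gt0.
move=> u; rewrite (le_trans (ler_normD _ _))// mulrDl lerD// (le_trans (mulmx_norm_le _ _))//.
  by rewrite ler_wpM2l ?(ltW (mxbound_gt0 _))// fst_norm_le.
by rewrite ler_wpM2l ?(ltW (mxbound_gt0 _))// snd_norm_le.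
Qed.

Lemma frame_XY : has_frame (X * Y)%type.
Proof. by apply: frame_prod; exact: frame_cV. Qed.

Lemma jac_strict_diff (s : X * Y -> Y) w : (forall j, Ck 1 (fun w => s w j 0)) ->
  strict_diff s w (jac_map s w).
Proof.
move=> s1; apply: strict_diff_mx => i j; rewrite (ord1 j).
have -> : (fun u => jac_map s w u i 0) = 'd (fun w' => s w' i 0) w.
  by apply/funext => u; rewrite jac_mapE//; case: (s1 i) => + _; apply.
exact: (C1_strict_diff frame_XY openT I (s1 i)).
Qed.

Lemma gradient_composed (f : X * Y -> R) (s : X * Y -> Y) w :
  differentiable f (w.1, s w) -> differentiable s w ->
  gradx (composed f s) w = gradx f (w.1, s w) + jacx s w *m grady f (w.1, s w) /\
  grady (composed f s) w = jacy s w *m grady f (w.1, s w).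
Proof.
move=> fd sd.
have fstd : differentiable (fst : X * Y -> X) w.
  by apply: linear_differentiable => u; exact: cvg_fst.
have pd : differentiable (fun w' : X * Y => (w'.1, s w')) w by exact: differentiable_pair.
have cd : differentiable (composed f s) w by exact: (differentiable_comp pd fd).
have E u : 'd (composed f s) w u = 'd f (w.1, s w) (u.1, 'd s w u).
  have /(congr1 (@^~ u)) E1 := diff_comp pd fd.
  have /(congr1 (@^~ u)) E2 := diff_pair fstd sd.
  have cf : continuous (fst : X * Y -> X) by move=> x; exact: cvg_fst.
  rewrite [LHS]E1 /= E2; congr ('d f _ (_, _)).
  by rewrite (@diff_lin _ _ _ (fst : {linear _ -> _}) w cf).
have Es u j : 'd s w u j 0 = 'd (fun w' => s w' j 0) w u.
  by have [_ ->] := diff_coord u j 0 sd.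
have sdj j : differentiable (fun w' => s w' j 0) w by have [] := diff_coord 0 j 0 sd.
split; apply/colP => i; rewrite !mxE deriveE// E diff_gradients//=.
  congr (_ + _).
    rewrite (bigD1 i)//= [X in _ * X]mxE !eqxx mulr1 big1 ?addr0; first by rewrite mxE.
    by move=> k ki; rewrite [X in _ * X]mxE (negPf ki) mulr0.
  by apply: eq_bigr => j _; rewrite Es mulrC 3!mxE (deriveE _ (sdj j)).
rewrite [X in X + _]big1 ?add0r; last by move=> k _; rewrite [X in _ * X]mxE mulr0.
by apply: eq_bigr => j _; rewrite Es mulrC 3!mxE (deriveE _ (sdj j)).
Qed.

End Gradients.

(** * Local structure of a Morse-Bott critical set *)

Section MorseBott.
Variable R : realType.

Lemma linear_is_mulmx (m n : nat) (L : 'cV[R]_n -> 'cV[R]_m) :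
  linear L -> exists M : 'M[R]_(m, n), forall v, L v = M *m v.
Proof.
move=> linL.
pose lM := GRing.isLinear.Build _ _ _ _ _ linL.
pose l : {linear _ -> _} := HB.pack L lM.
exists (\matrix_(i, j) L (delta_mx j 0) i 0) => v.
rewrite -[L v]/(l v) {1}(cV_basis v) linear_sum; apply/colP => i.
rewrite summxE mxE; apply: eq_bigr => j _.
by rewrite linearZ !mxE mulrC.
Qed.

Lemma diff_left_inverse (V W : normedModType R) (U : set V) (f : V -> W)
    (f' : W -> V) (a u : V) :
  open U -> U a -> (forall v, U v -> f' (f v) = v) ->
  differentiable f a -> differentiable f' (f a) -> 'd f' (f a) ('d f a u) = u.
Proof.
move=> oU Ua f'K fd fd'.
rewrite -[LHS]/(('d f' (f a) \o 'd f a) u) -diff_comp// -deriveE; last exact: differentiable_comp.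
rewrite -[RHS](derive_id a u); apply: near_eq_derive.
by near=> v; apply: f'K; near: v; exact: open_nbhs_nbhs.
Unshelve. all: by end_near. Qed.

Lemma pid_mx_coord (n k : nat) (v : 'cV[R]_n) i :
  ((pid_mx k : 'M[R]_n) *m v) i 0 = if (i < k)%N then v i 0 else 0.
Proof.
rewrite mxE (bigD1 i)//= big1 ?addr0 => [|j ji]; last first.
  by rewrite mxE (inj_eq val_inj) eq_sym (negPf ji) mul0r.
by rewrite mxE eqxx /=; case: ifP => _; rewrite ?mul1r ?mul0r.
Qed.

Variables (p d : nat).
Local Notation X := 'cV[R]_p.
Local Notation Y := 'cV[R]_d.

Lemma jac_map_col_mx (s : X * Y -> Y) w u :
  jac_map s w u = (col_mx (jacx s w) (jacy s w))^T *m col_mx u.1 u.2.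
Proof. by rewrite tr_col_mx mul_row_col. Qed.

(** Used to turn a small-o estimate along a ray into a vanishing derivative or a sign. *)
Lemma le0_of_small_multiples (a c : R) : 0 <= c -> (forall e, 0 < e -> a <= e * c) -> a <= 0.
Proof.
move=> c0 h; apply/ler_addgt0Pr => e e0; rewrite add0r.
have c1 : 0 < 1 + c by rewrite ltr_wpDr.
apply: le_trans (h (e / (1 + c)) _) _; first by rewrite divr_gt0.
by rewrite -mulrA ler_piMr ?(ltW e0)// mulrC ler_pdivrMr ?mul1r ?lerDr.
Qed.

(** With [q = psi w], let [a] be the projection of [q] to the flattened critical set
and [b = q - a]. Since G vanishes at [a], strict differentiability gives
G(w) = N b + o(b), where N is injective on the complementary coordinates; so
|b| = O(|G(w)|). As the range of N is contained in that of the Hessian in y, P0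
kills N b and only the remainder is left. *)
Lemma morse_bott_local (g : X * Y -> R) (w0 : X * Y) :
  (forall j, Ck 1 (fun w => grady g w j 0)) -> parametric_Morse_Bott g ->
  grady g w0 = 0 ->
  (hessxy g w0 <= hessyy g w0)%MS /\
  forall P0 : 'M[R]_d, P0 *m (hessyy g w0)^T = 0 -> forall e : R, 0 < e ->
  exists2 r : R, 0 < r & forall w, `|w - w0| < r ->
    `|P0 *m grady g w| <= e * `|grady g w|.
Proof.
move=> g2 gMB G0.
have [V [oV Vw0 _ [kn]]] := gMB w0 G0.
set k := (p + _)%N in kn *.
move=> /(_ w0 (conj G0 Vw0)) [U [W [psi [psi' [[oU Uw0 oW psiU] [psi2 psi'2 psiK psiS]]]]]].
set A := hessyy g w0; set B := hessxy g w0.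
pose q0 := psi w0.
have Wq0 : W q0 by rewrite -psiU; exists w0.
have psi'W q : W q -> U (psi' q) /\ psi (psi' q) = q.
  by rewrite -psiU => -[e Ue <-]; rewrite psiK.
have zeroW q : W q -> (forall i : 'I_(p + d), (k <= i)%N -> q i 0 = 0) -> grady g (psi' q) = 0.
  move=> Wq qk; have [Uq qE] := psi'W q Wq.
  by have [_ /(_ _) []] := psiS (psi' q) Uq; rewrite ?qE.
have q0k (i : 'I_(p + d)) : (k <= i)%N -> q0 i 0 = 0.
  by apply: (psiS w0 Uw0).1; split.
have psid : differentiable psi w0 by case: psi2 => + _; apply.
have psi'1 := Ck_C1 psi'2.
have psi'd : differentiable psi' q0 by case: psi'2 => + _; apply.
pose vec (u : X * Y) : 'cV[R]_(p + d) := col_mx u.1 u.2.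
pose unv (v : 'cV[R]_(p + d)) : X * Y := (usubmx v, dsubmx v).
have vecK v : vec (unv v) = v by rewrite /vec/= vsubmxK.
have [Psi' Psi'E] : exists M : 'M[R]_(p + d), forall v, vec ('d psi' q0 v) = M *m v.
  apply: linear_is_mulmx => c u v; rewrite /vec linearP/= -add_col_mx -scale_col_mx.
  by [].
have [Psi PsiE] : exists M : 'M[R]_(p + d), forall v, 'd psi w0 (unv v) = M *m v.
  apply: linear_is_mulmx => c u v.
  have -> : unv (c *: u + v) = c *: unv u + unv v by rewrite /unv !linearP.
  by rewrite linearP.
have Psi1 : Psi' *m Psi = 1%:M.
  apply/matrixP => i j.
  have /colP /(_ i) : (Psi' *m Psi) *m delta_mx j 0 = delta_mx j 0 :> 'cV_(p + d).
    by rewrite -mulmxA -PsiE -Psi'E (diff_left_inverse _ oU Uw0 psiK psid)// vecK.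
  by rewrite -colE !mxE eqxx andbT.
(* The derivative of G read in the chart. *)
pose N := (col_mx B A)^T *m Psi'.
have Gt_strict : strict_diff (grady g \o psi') q0 (fun v => N *m v).
  have -> : (fun v => N *m v) = jac_map (grady g) w0 \o 'd psi' q0.
    by apply/funext => v /=; rewrite jac_map_col_mx -mulmxA -Psi'E.
  apply: strict_diff_comp.
  - exact: jac_mapB.
  - exact/linear_lipschitz/diff_continuous.
  - exact: jac_map_bound.
  - have [f1 f2] := Ck1_pair oW psi'1.
    apply: strict_diff_pair; apply: strict_diff_mx => i j; rewrite (ord1 j).
      have -> : (fun v => ('d psi' q0 v).1 i 0) = 'd (fun v => (psi' v).1 i 0) q0.
        apply/funext => v; have fd : differentiable (fun v => (psi' v).1) q0 by case: f1 => + _; apply.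
        by have [_ ->] := diff_coord v i 0 fd; have [-> _] := diff_pair_components v psi'd.
      exact: (C1_strict_diff (@frame_cV _ _) oW Wq0 (Ck1_coord i 0 oW f1)).
    have -> : (fun v => ('d psi' q0 v).2 i 0) = 'd (fun v => (psi' v).2 i 0) q0.
      apply/funext => v; have fd : differentiable (fun v => (psi' v).2) q0 by case: f2 => + _; apply.
      by have [_ ->] := diff_coord v i 0 fd; have [_ ->] := diff_pair_components v psi'd.
    exact: (C1_strict_diff (@frame_cV _ _) oW Wq0 (Ck1_coord i 0 oW f2)).
  - by rewrite /q0 psiK//; exact: jac_strict_diff.
have /nbhs_normP[rW /= rW0 rWP] : nbhs q0 W by exact: open_nbhs_nbhs.
have Nker (v : 'cV[R]_(p + d)) :
    (forall i : 'I_(p + d), (k <= i)%N -> v i 0 = 0) -> N *m v = 0.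
  move=> vk; apply/eqP; rewrite -normr_le0; apply: (@le0_of_small_multiples _ `|v|) => // e e0.
  have [r r0 rP] := Gt_strict e e0.
  (* A step short enough to stay in the chart, where all of the ray is critical. *)
  pose t := Num.min r rW / (1 + `|v|).
  have v1 : 0 < 1 + `|v| by rewrite ltr_wpDr.
  have m0 : 0 < Num.min r rW by rewrite lt_min r0.
  have t0 : 0 < t by rewrite divr_gt0.
  have tv : `|t *: v| < Num.min r rW.
    rewrite normrZ gtr0_norm// /t -mulrA -{2}[Num.min r rW]mulr1 ltr_pM2l//.
    by rewrite mulrC ltr_pdivrMr// mul1r ltrDr.
  move: tv; rewrite lt_min => /andP[tvr tvW].
  have qt : W (q0 + t *: v) by apply: rWP; rewrite /= opprD addrA subrr sub0r normrN.
  have := rP (q0 + t *: v) q0; rewrite addrAC subrr add0r normr0 => /(_ tvr r0).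
  rewrite /= !zeroW// => [|i ki]; last by rewrite !mxE vk// q0k// mulr0 addr0.
  have -> : `|0 - 0 - N *m (t *: v)| = t * `|N *m v|.
    by rewrite subr0 sub0r normrN -scalemxAr normrZ gtr0_norm.
  have -> : `|t *: v| = t * `|v| by rewrite normrZ gtr0_norm.
  by rewrite mulrCA (ler_pM2l t0).
have Npid : N *m (pid_mx k : 'M[R]_(p + d)) = 0.
  apply/matrixP => i j; rewrite [RHS]mxE.
  have /colP /(_ i) : N *m (pid_mx k : 'M[R]_(p + d)) *m delta_mx j 0 = 0 :> 'cV[R]_d.
    by rewrite -mulmxA; apply: Nker => l kl; rewrite pid_mx_coord ltnNge kl.
  by rewrite -colE !mxE.
have [BA [Q QN]] := chart_rank Psi1 Npid.
split=> // P0 P0A e e0.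
have P0N : P0 *m N = 0.
  have /submxP[E BE] := BA.
  rewrite /N mulmxA tr_col_mx mul_mx_row P0A BE trmx_mul mulmxA P0A mul0mx.
  by rewrite row_mx0 mul0mx.
have CQ0 := mxbound_gt0 Q; have CP0 := mxbound_gt0 P0.
(* The first bound absorbs the remainder in |b| <= |Q| (|G| + e1 |b|), the second
   one makes |P0| e1 |b| at most e |G|. *)
pose e1 := Num.min (1 / (2 * mxbound Q)) (e / (2 * mxbound P0 * mxbound Q)).
have e10 : 0 < e1 by rewrite lt_min !divr_gt0// !mulr_gt0.
have [r1 r10 r1P] := Gt_strict e1 e10.
pose c := mxbound (pid_mx k : 'M[R]_(p + d)).
have c0 : 0 < c by exact: mxbound_gt0.
pose r2 := Num.min (Num.min r1 rW) (Num.min r1 rW / c).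
have m0 : 0 < Num.min r1 rW by rewrite lt_min r10.
have r20 : 0 < r2 by rewrite lt_min m0 divr_gt0.
have /nbhs_normP[r /= r0 rP] : \forall w \near w0, U w /\ `|q0 - psi w| < r2.
  near=> w; split; first by near: w; exact: open_nbhs_nbhs.
  near: w; have /cvgrPdist_lt := differentiable_continuous psid; exact.
exists r => // w wr; have [Uw] := rP w ltac:(by rewrite /= distrC).
set q := psi w => qr.
pose b := (copid_mx k : 'M[R]_(p + d)) *m q.
pose a := (pid_mx k : 'M[R]_(p + d)) *m q.
have ab : q - a = b by rewrite /a /b mulmxBl mul1mx.
have q0E : (pid_mx k : 'M[R]_(p + d)) *m q0 = q0.
  by apply/colP => i; rewrite pid_mx_coord; case: ltnP => // /q0k.
have aq : `|a - q0| < Num.min r1 rW.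
  rewrite -q0E -mulmxBr (le_lt_trans (mulmx_norm_le _ _))// mulrC -ltr_pdivlMr//.
  by rewrite distrC (lt_le_trans qr)// ge_min lexx orbT.
have qq : `|q - q0| < Num.min r1 rW by rewrite distrC (lt_le_trans qr)// ge_min lexx.
move: aq qq; rewrite !lt_min => /andP[aq1 aqW] /andP[qq1 _].
have Ga : grady g (psi' a) = 0.
  apply: zeroW => [|i ki]; first by apply: rWP; rewrite /= distrC.
  by rewrite pid_mx_coord ltnNge ki.
have := r1P q a qq1 aq1; rewrite /= Ga subr0 ab psiK// => est.
have bE : b = Q *m (N *m b) by rewrite mulmxA -QN /b mulmxA copid_mx_id.
have b1 : `|b| <= mxbound Q * (`|grady g w| + e1 * `|b|).
  rewrite {1}bE (le_trans (mulmx_norm_le _ _))// ler_wpM2l ?(ltW CQ0)//.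
  have -> : N *m b = grady g w - (grady g w - N *m b) by rewrite opprB addrC subrK.
  by rewrite (le_trans (ler_normB _ _))// lerD2l.
have b2 : `|b| <= 2 * mxbound Q * `|grady g w|.
  have : mxbound Q * (e1 * `|b|) <= `|b| / 2.
    rewrite mulrA mulrC ler_wpM2l// mulrC -ler_pdivlMr// -[leRHS]mulr1 -invfM.
    by rewrite /e1 ge_min mul1r mulr1 lexx.
  by move: b1; rewrite mulrDr; lra.
have -> : P0 *m grady g w = P0 *m (grady g w - N *m b) by rewrite mulmxBr mulmxA P0N mul0mx subr0.
rewrite (le_trans (mulmx_norm_le _ _))// (le_trans (ler_wpM2l (ltW CP0) est))//.
have : e1 <= e / (2 * mxbound P0 * mxbound Q) by rewrite /e1 ge_min lexx orbT.
rewrite ler_pdivlMr ?mulr_gt0// => e1e.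
have : mxbound P0 * e1 * `|b| <= mxbound P0 * e1 * (2 * mxbound Q * `|grady g w|).
  by rewrite ler_wpM2l// mulr_ge0// ltW.
move=> h; rewrite mulrA (le_trans h)//.
have -> : mxbound P0 * e1 * (2 * mxbound Q * `|grady g w|) =
  e1 * (2 * mxbound P0 * mxbound Q) * `|grady g w| by ring.
by rewrite ler_wpM2r.
Unshelve. all: by end_near. Qed.

End MorseBott.

(** * Convergence of a gradient flow to equilibrium *)

Section Flow.
Variables (R : realType) (d : nat).
Local Notation Y := 'cV[R]_d.

Definition dot (u v : Y) : R := \sum_i u i 0 * v i 0.

Lemma sup_norm_sq_le_dot (u : Y) : `|u| ^+ 2 <= dot u u.
Proof.
have D0 : 0 <= dot u u by apply: sumr_ge0 => i _; rewrite -expr2 sqr_ge0.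
rewrite -(sqr_sqrtr D0) ler_pXn2r// ?nnegrE ?sqrtr_ge0//.
apply: mx_norm_le => [|i j]; rewrite ?sqrtr_ge0// -(ler_pXn2r (ltn0Sn 1)) ?nnegrE ?sqrtr_ge0//.
rewrite (sqr_sqrtr D0) (ord1 j) real_normK ?num_real// /dot (bigD1 i)//= expr2 lerDl.
by apply: sumr_ge0 => k _; rewrite -expr2 sqr_ge0.
Qed.

Lemma dot_ge0 (u : Y) : 0 <= dot u u.
Proof. by apply: le_trans (sup_norm_sq_le_dot u); rewrite sqr_ge0. Qed.

Lemma dotNr (u v : Y) : dot u (- v) = - dot u v.
Proof. by rewrite /dot -sumrN; apply: eq_bigr => i _; rewrite mxE mulrN. Qed.

Lemma lim_norm_le (V : normedModType R) (T : Type) (F : set_system T) {FF : ProperFilter F}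
   (f : T -> V) (l : V) (K : R) :
  f @ F --> l -> (\forall t \near F, `|f t| <= K) -> `|l| <= K.
Proof.
move=> fl fK; apply/ler_addgt0Pl => e e0.
have fe : \forall t \near F, `|l - f t| <= e by move/cvgrPdist_le: fl; apply.
have [t [lt Kt]] := filter_ex (filterI fe fK).
by rewrite -(subrK (f t) l) (le_trans (ler_normD _ _))// lerD.
Qed.

Lemma diff_dot_self (c : Y -> Y) (v u : Y) : differentiable c v ->
  differentiable (fun w => dot (c w) (c w)) v /\
  'd (fun w => dot (c w) (c w)) v u = 2 * dot (c v) ('d c v u).
Proof.
move=> cd.
have cj j : differentiable (fun w => c w j 0) v by have [] := diff_coord 0 j 0 cd.
have E : (fun w => dot (c w) (c w)) = \sum_(j < d) ((fun w => c w j 0) * (fun w => c w j 0)).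
  by apply/funext => w; rewrite fct_sumE.
have dj j : differentiable ((fun w => c w j 0) * (fun w => c w j 0)) v by exact: differentiableM.
have ds : differentiable (fun w => dot (c w) (c w)) v by rewrite E; exact: differentiable_sum.
split=> //; rewrite -deriveE// E derive_sum => [|j]; last exact: diff_derivable.
rewrite /dot mulr_sumr; apply: eq_bigr => j _.
rewrite deriveM; try exact: diff_derivable.
rewrite deriveE//; have [_ ->] := diff_coord u j 0 cd.
by rewrite /GRing.scale/=; ring.
Qed.

Variables (G : Y -> Y) (y : R -> Y).
Hypothesis Gd : forall v, differentiable G v.
Hypothesis yc : {within `[0, +oo[, continuous y}.
Hypothesis yd : forall t : R, 0 < t -> is_derive t (1:R) y (- G (y t)).

(** A single differential inequality serves two purposes: [b > 0] and [C = 0] give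
exponential decay of [q], while [b = 0] and [a < 0] bound the drift of [q] by the
integral of an exponentially decaying speed, without integrating. *)
Lemma nincr_along_flow (q : Y -> R) (a b C T : R) :
  (forall v, differentiable q v) ->
  (forall t, 0 < t < T ->
     expR (b * t) * (b * q (y t) - 'd q (y t) (G (y t))) + C * (a * expR (a * t)) <= 0) ->
  forall s t, 0 <= s -> s <= t -> t <= T ->
   q (y t) * expR (b * t) + C * expR (a * t) <= q (y s) * expR (b * s) + C * expR (a * s).
Proof.
move=> qd qle s t s0 st tT.
pose h := ((q \o y) * (fun t => expR (b * t)) + C *: (fun t : R => expR (a * t)) : R -> R).
have expd (k t0 : R) : is_derive t0 1 (fun t => expR (k * t)) (k * expR (k * t0)).
  have kd : is_derive t0 1 (k \*: (@id R)) (k *: 1) by exact: is_deriveZ.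
  have := is_derive1_comp (is_derive_expR ((k \*: (@id R)) t0)) kd.
  by rewrite /GRing.scale/= mulr1 mulrC.
have hd (t0 : R) : 0 < t0 -> is_derive t0 1 h
    (expR (b * t0) * (b * q (y t0) - 'd q (y t0) (G (y t0))) + C * (a * expR (a * t0))).
  move=> t00.
  have [yd1 yd2] := yd t00.
  have ydiff : differentiable y t0 by apply/derivable1_diffP.
  have qyd : differentiable (q \o y) t0 by exact: differentiable_comp.
  have qy : is_derive t0 1 (q \o y) (- 'd q (y t0) (G (y t0))).
    apply: DeriveDef; first exact: diff_derivable.
    rewrite deriveE// (diff_comp ydiff (qd _))/=.
    by rewrite -(deriveE (1 : R) ydiff) yd2 linearN.
  have := is_deriveD (is_deriveM qy (expd b t0)) (is_deriveZ C (expd a t0)).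
  by congr (is_derive _ _ _ _); rewrite /GRing.scale/=; ring.
have expc k : continuous (fun t : R => expR (k * t)).
  by move=> u; apply: differentiable_continuous; apply/derivable1_diffP; have [] := expd k u.
have hc : {within `[0, +oo[, continuous h}.
  move=> t0; apply: continuousD.
    apply: continuousM; first by apply: continuous_comp; [exact: yc|exact: differentiable_continuous].
    by apply: (@continuous_subspaceT _ _ _ (fun t : R => expR (b * t))); exact: expc.
  apply: (@continuous_subspaceT _ _ _ (fun t : R => C * expR (a * t))) => u.
  by apply: cvgM; [exact: cvg_cst|exact: expc].
have : h t <= h s; last by [].
apply: (@ler0_derive1_le_cc _ h 0 T).
- by move=> u; rewrite in_itv/= => /andP[u0 _]; have [] := hd u u0.
- move=> u; rewrite in_itv/= => uT; rewrite derive1E.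
  by have [_ ->] := hd u (proj1 (andP uT)); exact: qle.
- by apply: (continuous_subspaceW _ hc) => u /=; rewrite !in_itv/= => /andP[->].
- by rewrite in_itv/= tT (le_trans s0).
- by rewrite in_itv/= s0 (le_trans st).
- exact: st.
Qed.

Variables (c delta : R) (c0 : 0 < c).
Hypothesis Gc : forall v, `|v - y 0| < delta -> c * dot (G v) (G v) <= dot (G v) ('d G v (G v)).
Let S := Num.sqrt (dot (G (y 0)) (G (y 0))).
Hypothesis Sdelta : S / c < delta.

Section Segment.
Variable T : R.
Hypothesis inball : forall t, 0 <= t < T -> `|y t - y 0| < delta.

(** |G|^2 decreases at rate 2 c as long as the trajectory is in the ball where the
coercivity [Gc] holds. *)
Lemma speed_decay t : 0 <= t -> t <= T -> `|G (y t)| <= S * expR (- c * t).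
Proof.
move=> t0 tT.
have qd v := (diff_dot_self 0 (Gd v)).1.
have := @nincr_along_flow (fun v => dot (G v) (G v)) 0 (2 * c) 0 T qd _ 0 t (lexx _) t0 tT.
rewrite !mul0r !addr0 mulr0 expR0 mulr1 => h.
have {}h : dot (G (y t)) (G (y t)) * expR (2 * c * t) <= dot (G (y 0)) (G (y 0)).
  apply: h => u /andP[u0 uT]; rewrite !mul0r addr0.
  rewrite (diff_dot_self _ (Gd _)).2 pmulr_rle0 ?expR_gt0// -mulrA -mulrBr.
  by rewrite pmulr_rle0// subr_le0; apply: Gc; apply: inball; rewrite (ltW u0).
rewrite -(ler_pXn2r (ltn0Sn 1)) ?nnegrE//; last by rewrite mulr_ge0 ?sqrtr_ge0// expR_ge0.
rewrite (le_trans (sup_norm_sq_le_dot _))// exprMn sqr_sqrtr ?dot_ge0// -expRM_natl.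
have -> : 2%:R * (- c * t) = - (2 * c * t) by ring.
by rewrite expRN -ler_pdivrMr ?invr_gt0 ?expR_gt0// invrK.
Qed.

(** The displacement seen through [P] is at most the integral of the speed seen
through [P], which decays exponentially. With [P = 1%:M] this is
the Cauchy property of the trajectory. *)
Lemma move_bound (P : 'M[R]_d) (e s t : R) : 0 <= e ->
  (forall v, `|v - y 0| < delta -> `|P *m G v| <= e * `|G v|) ->
  0 <= s -> s <= t -> t <= T -> `|P *m (y t - y s)| <= e * S / c * expR (- c * s).
Proof.
move=> e0 PG s0 st tT.
have K0 : 0 <= e * S / c by rewrite !mulr_ge0 ?sqrtr_ge0 ?invr_ge0// ltW.
apply: mx_norm_le => [|i j]; first by rewrite mulr_ge0 ?expR_ge0.
rewrite {j}(ord1 j) ler_norml; apply/andP.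
have key (P' : 'M[R]_d) : (forall v, `|v - y 0| < delta -> `|P' *m G v| <= e * `|G v|) ->
    (P' *m (y t - y s)) i 0 <= e * S / c * expR (- c * s).
  move=> P'G.
  have P'c : continuous (mulmx P' : Y -> Y) by exact: mulmx_continuous.
  have P'd v : differentiable (mulmx P' : Y -> Y) v by exact: linear_differentiable.
  have qd v : differentiable (fun v : Y => (P' *m v) i 0) v.
    by have [] := diff_coord 0 i 0 (P'd v).
  have := @nincr_along_flow (fun v => (P' *m v) i 0) (- c) 0 (e * S / c) T qd _ s t s0 st tT.
  rewrite !mul0r expR0 !mulr1 => h.
  have {}h : (P' *m y t) i 0 + e * S / c * expR (- c * t) <=
      (P' *m y s) i 0 + e * S / c * expR (- c * s).
    apply: h => u /andP[u0 uT]; rewrite !mul0r expR0 mul1r sub0r.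
    have -> : 'd (fun v : Y => (P' *m v) i 0) (y u) (G (y u)) = (P' *m G (y u)) i 0.
      by have [_ ->] := diff_coord (G (y u)) i 0 (P'd (y u)); rewrite diff_lin.
    have -> : e * S / c * (- c * expR (- c * u)) = - (e * (S * expR (- c * u))).
      by field; rewrite gt_eqF.
    rewrite -opprD oppr_le0 -lerBlDr sub0r.
    have yu : `|y u - y 0| < delta by apply: inball; rewrite (ltW u0).
    have := entry_norm_le (P' *m G (y u)) i 0; rewrite ler_norml => /andP[+ _].
    apply: le_trans; rewrite lerN2 (le_trans (P'G _ yu))// ler_wpM2l//.
    by rewrite speed_decay// ltW.
  rewrite mulmxBr !mxE in h *.
  have : 0 <= e * S / c * expR (- c * t) by rewrite mulr_ge0 ?expR_ge0.
  lra.
split; last exact: key.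
have := key (- P); rewrite mulNmx mxE lerNl; apply=> v vd.
by rewrite mulNmx normrN; exact: PG.
Qed.

End Segment.

Lemma ball_extends T : 0 <= T -> (forall t, 0 <= t < T -> `|y t - y 0| < delta) ->
  `|y T - y 0| <= S / c.
Proof.
move=> T0 inball.
have := @move_bound T inball 1%:M 1 0 T ler01 _ (lexx 0) T0 (lexx T).
rewrite mul1mx mulr0 expR0 mulr1 mul1r; apply=> v _.
by rewrite mul1mx mul1r.
Qed.

(** The first exit time [tau] cannot exist: up to [tau] the total displacement is at
most [S / c], which is smaller than the radius. *)
Lemma stays_in_ball t : 0 <= t -> `|y t - y 0| < delta.
Proof.
move=> t0; rewrite ltNge; apply/negP => td.
pose E := [set s : R | 0 <= s /\ delta <= `|y s - y 0|].
have E0 : E !=set0 by exists t.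
have Elb : lbound E 0 by move=> s [].
have iE : has_inf E by split => //; exists 0.
pose tau := inf E.
have tau0 : 0 <= tau by exact: lb_le_inf.
have below s : 0 <= s < tau -> `|y s - y 0| < delta.
  move=> /andP[s0 stau]; rewrite ltNge; apply/negP => sd.
  by have := ge_inf iE.2 (conj s0 sd : E s); rewrite leNgt stau.
have := ball_extends tau0 below => ytau.
have room : 0 < delta - S / c by rewrite subr_gt0.
have cont : y @ within `[0, +oo[ (nbhs tau) --> y tau.
  by move/subspace_continuousP: yc; apply; rewrite /= in_itv/= tau0.
have /nbhs_normP[r /= r0 rP] : \forall s \near tau, 0 <= s -> `|y tau - y s| < delta - S / c.
  move/cvgrPdist_lt: cont => /(_ _ room).
  by rewrite near_withinE; apply: filterS => s; rewrite /= in_itv/= andbT.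
have [s [s0 sd] sr] := inf_adherent r0 iE.
have ss : tau <= s by apply: (ge_inf iE.2).
have := rP s; rewrite /= distrC ger0_norm ?subr_ge0// ltrBlDl => /(_ sr s0) ys.
have : `|y s - y 0| < delta.
  rewrite -(subrK (y tau) (y s)) -addrA (le_lt_trans (ler_normD _ _))// distrC.
  by rewrite -(subrK (S / c) delta) ltr_leD.
by rewrite ltNge sd.
Qed.

(** The bound for an arbitrary matrix [P] is what later shows that the displacement
is negligible in the kernel of the Hessian. *)
Lemma flow_limit : exists yinf : Y, [/\ y t @[t --> +oo] --> yinf, G yinf = 0,
  `|yinf - y 0| <= S / c &
  forall (P : 'M[R]_d) (e : R), 0 <= e ->
    (forall v, `|v - y 0| < delta -> `|P *m G v| <= e * `|G v|) ->
    `|P *m (yinf - y 0)| <= e * S / c].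
Proof.
have inb T t : 0 <= t < T -> `|y t - y 0| < delta by move=> /andP[t0 _]; exact: stays_in_ball.
have S0 : 0 <= S by exact: sqrtr_ge0.
have expsmall (K e : R) : 0 <= K -> 0 < e -> exists2 s : R, 0 <= s & K * expR (- c * s) <= e.
  move=> K0 e0; exists (K / (c * e)); first by rewrite divr_ge0// mulr_ge0// ltW.
  have -> : - c * (K / (c * e)) = - (K / e) by field; rewrite !gt_eqF.
  rewrite expRN ler_pdivrMr ?expR_gt0//.
  apply: le_trans (ler_wpM2l (ltW e0) (expR_ge1Dx (K / e))).
  by rewrite mulrDr mulr1 mulrC divfK ?gt_eqF// lerDr ltW.
have mv (s t : R) : 0 <= s -> s <= t -> `|y t - y s| <= S / c * expR (- c * s).
  move=> s0 st; have := @move_bound t (inb t) 1%:M 1 s t ler01 _ s0 st (lexx t).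
  by rewrite mul1mx mul1r; apply=> v _; rewrite mul1mx mul1r.
have [yinf ylim] : exists yinf : Y, y t @[t --> +oo] --> yinf.
  have : cvg (y @ +oo).
    apply/cauchy_cvgP/cauchy_exP => e e0.
    have [s s0 se] := expsmall (S / c) (e / 2) (divr_ge0 S0 (ltW c0)) (divr_gt0 e0 (ltr0Sn _ _)).
    exists (y s).
    have : \forall t \near +oo, s <= t by apply: nbhs_pinfty_ge; exact: num_real.
    apply: filterS => t st; rewrite -ball_normE/= distrC.
    rewrite (le_lt_trans (mv s t s0 st))// (le_lt_trans se)//.
    by rewrite ltr_pdivrMr// ltr_pMr// ltr1n.
  by move=> yl; exists (lim (y @ +oo)).
exists yinf.
have near0 : \forall t \near +oo, 0 <= t :> R by apply: nbhs_pinfty_ge; exact: num_real.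
have Pbound (P : 'M[R]_d) (e : R) : 0 <= e ->
    (forall v, `|v - y 0| < delta -> `|P *m G v| <= e * `|G v|) ->
    `|P *m (yinf - y 0)| <= e * S / c.
  move=> e0 PG.
  have lim1 : P *m (y t - y 0) @[t --> +oo] --> P *m (yinf - y 0).
    apply: (@cvg_mulmx _ _ _ _ _ _ _ (fun=> P) (fun t => y t - y 0)); first exact: cvg_cst.
    by apply: cvgB; [exact: ylim|exact: cvg_cst].
  apply: (lim_norm_le lim1); apply: filterS near0 => t t0.
  have := @move_bound t (inb t) P e 0 t e0 PG (lexx 0) t0 (lexx t).
  by rewrite mulr0 expR0 mulr1.
split=> //.
  apply/eqP; rewrite -normr_le0; apply/ler_addgt0Pl => e e0; rewrite addr0.
  have Gl : G (y t) @[t --> +oo] --> G yinf.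
    exact: (@cvg_comp _ _ _ y G _ _ _ ylim (differentiable_continuous (Gd yinf))).
  apply: (lim_norm_le Gl).
  have [s s0 se] := expsmall S e S0 e0.
  have : \forall t \near +oo, s <= t by apply: nbhs_pinfty_ge; exact: num_real.
  apply: filterS => t st; have t0 := le_trans s0 st.
  apply: le_trans (@speed_decay t (inb t) t t0 (lexx t)) _; apply: le_trans se.
  by rewrite ler_wpM2l// ler_expR !mulNr lerN2 ler_pM2l.
have := Pbound 1%:M 1 ler01; rewrite mul1mx mul1r; apply=> v _.
by rewrite mul1mx mul1r.
Qed.

End Flow.

(** * Euclidean products, least squares, positive semidefinite matrices *)

Section DotAlgebra.
Variables (R : realType) (d : nat).
Local Notation Y := 'cV[R]_d.
Implicit Types u v w : Y.

Lemma dotC u v : dot u v = dot v u.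
Proof. by apply: eq_bigr => i _; rewrite mulrC. Qed.

Lemma dotDr u v w : dot u (v + w) = dot u v + dot u w.
Proof. by rewrite /dot -big_split/=; apply: eq_bigr => i _; rewrite mxE mulrDr. Qed.

Lemma dotZr u v a : dot u (a *: v) = a * dot u v.
Proof. by rewrite /dot mulr_sumr; apply: eq_bigr => i _; rewrite mxE mulrCA. Qed.

Lemma dotBr u v w : dot u (v - w) = dot u v - dot u w.
Proof. by rewrite dotDr dotNr. Qed.

Lemma dot_BZ (a b a' b' : Y) (t : R) : dot (a - t *: b) (a' - t *: b') =
  dot a a' - t * (dot a b' + dot b a') + t ^+ 2 * dot b b'.
Proof.
have L (u v w : Y) : dot (u - v) w = dot u w - dot v w by rewrite !(dotC _ w) dotBr.
have LZ s (u w : Y) : dot (s *: u) w = s * dot u w by rewrite !(dotC _ w) dotZr.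
by rewrite !L !LZ !dotBr !dotZr; ring.
Qed.

Lemma dot_mulmx u v (M : 'M[R]_d) : dot u (M *m v) = dot (M^T *m u) v.
Proof.
rewrite /dot; under eq_bigr do rewrite mxE mulr_sumr.
rewrite exchange_big/=; apply: eq_bigr => j _; rewrite mxE mulr_suml.
by apply: eq_bigr => i _; rewrite !mxE mulrA [M i j * _]mulrC.
Qed.

Lemma dot_eq0 u : dot u u = 0 -> u = 0.
Proof.
move=> u0; apply/eqP; rewrite -normr_eq0 -sqrf_eq0 eq_le sqr_ge0 andbT -u0.
exact: sup_norm_sq_le_dot.
Qed.

Lemma dot_norm_le u v : `|dot u v| <= d%:R * (`|u| * `|v|).
Proof.
rewrite (le_trans (ler_norm_sum _ _ _))//.
apply: (@le_trans _ _ (\sum_(k < d) `|u| * `|v|)).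
  by apply: ler_sum => k _; rewrite normrM ler_pM// entry_norm_le.
by rewrite sumr_const card_ord -[leLHS]mulr_natl.
Qed.

(** The normal equation of the least-squares problem is A^2 (A^2 z + v) = 0; a
symmetric matrix and its square have the same kernel. *)
Lemma least_squares_normal (A : 'M[R]_d) (v z : Y) : A^T = A ->
  (forall z', enorm (A *m A *m z + v) ^+ 2 <= enorm (A *m A *m z' + v) ^+ 2) ->
  A *m (A *m A *m z + v) = 0.
Proof.
move=> sA; set e := A *m A *m z + v => emin.
have enE (u : Y) : enorm u ^+ 2 = dot u u.
  rewrite /enorm sqr_sqrtr; last by apply: sumr_ge0 => i _; rewrite sqr_ge0.
  by apply: eq_bigr => i _; rewrite expr2.
have dotS (u w : Y) : dot u (A *m w) = dot (A *m u) w by rewrite dot_mulmx sA.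
pose D := dot (A *m (A *m e)) (A *m (A *m e)).
pose q := dot (A *m (A *m (A *m (A *m e)))) (A *m (A *m (A *m (A *m e)))).
have q0 : 0 <= q by exact: dot_ge0.
have D0 : 0 <= D by exact: dot_ge0.
have h t : 0 <= - (2 * t * D) + t ^+ 2 * q.
  have := emin (z - t *: (A *m (A *m e))); rewrite !enE.
  have -> : A *m A *m (z - t *: (A *m (A *m e))) + v = e - t *: (A *m (A *m (A *m (A *m e)))).
    by rewrite mulmxBr addrAC -/e -scalemxAr -!mulmxA.
  rewrite dot_BZ (dotC _ e).
  have -> : dot e (A *m (A *m (A *m (A *m e)))) = D by rewrite dotS dotS.
  rewrite -/q; lra.
(* Unless D = 0, the quadratic in h is negative at t = D / (q + 1). *)
have D00 : D = 0.
  apply/eqP; rewrite eq_le D0 andbT leNgt; apply/negP => Dp.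
  have q1 : 0 < q + 1 by rewrite ltr_wpDl.
  have := h (D / (q + 1)).
  have -> : - (2 * (D / (q + 1)) * D) + (D / (q + 1)) ^+ 2 * q =
    - (D / (q + 1)) ^+ 2 * (q + 2) by field; rewrite gt_eqF.
  rewrite mulNr oppr_ge0 leNgt; apply/negP; rewrite negbK mulr_gt0//; last by rewrite ltr_wpDl.
  by rewrite exprn_gt0// divr_gt0.
have AAe : A *m (A *m e) = 0 by exact: dot_eq0.
by apply: dot_eq0; rewrite -dotS AAe /dot big1// => i _; rewrite [X in _ * X]mxE mulr0.
Qed.

(** For positive semidefinite [A], |A v|^2 <= m <v, A v> for some [m]; and |A v|
controls |v| when the component [P0 *m v] is at most half of [v]. *)
Lemma psd_coercive (A Q P0 : 'M[R]_d) : A^T = A -> (forall v, 0 <= dot v (A *m v)) ->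
  Q *m A + P0 = 1%:M ->
  exists2 c, 0 < c & forall v, `|P0 *m v| <= 1 / 2 * `|v| -> c * `|v| ^+ 2 <= dot v (A *m v).
Proof.
move=> sA psd QP.
pose m := d%:R * mxbound A + 1.
have m0 : 0 < m by rewrite ltr_wpDl// mulr_ge0// ltW// mxbound_gt0.
have Q0 := mxbound_gt0 Q.
exists ((m * (2 * mxbound Q) ^+ 2)^-1); first by rewrite invr_gt0 mulr_gt0// exprn_gt0// mulr_gt0.
move=> v vP.
pose D := dot (A *m v) (A *m v).
have D1 : D <= m * dot v (A *m v).
  (* One step of gradient descent on <v, A v>, as in the proof of Cauchy-Schwarz. *)
  have := psd (v - m^-1 *: (A *m v)).
  have E1 : dot (A *m v) (A *m (A *m v)) <= m * D.
    apply: (@le_trans _ _ (d%:R * mxbound A * `|A *m v| ^+ 2)).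
      rewrite (le_trans (ler_norm _))// (le_trans (dot_norm_le _ _))// -mulrA ler_wpM2l//.
      by rewrite expr2 mulrCA ler_wpM2l// mulmx_norm_le.
    by rewrite ler_pM ?mulr_ge0 ?sqr_ge0 ?(ltW (mxbound_gt0 _))//; [rewrite /m lerDl|exact: sup_norm_sq_le_dot].
  have -> : dot (v - m^-1 *: (A *m v)) (A *m (v - m^-1 *: (A *m v))) =
     dot v (A *m v) - 2 * m^-1 * D + m^-1 ^+ 2 * dot (A *m v) (A *m (A *m v)).
    rewrite mulmxBr -scalemxAr dot_BZ [dot v (A *m (A *m v))]dot_mulmx sA -/D; ring.
  move=> h.
  have : m^-1 ^+ 2 * dot (A *m v) (A *m (A *m v)) <= m^-1 * D.
    rewrite expr2 -mulrA ler_wpM2l ?invr_ge0 ?(ltW m0)//.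
    by rewrite mulrC ler_pdivrMr// mulrC.
  move=> h2; have : m^-1 * D <= dot v (A *m v) by lra.
  by rewrite mulrC ler_pdivrMr// mulrC.
have v1 : `|v| <= 2 * mxbound Q * `|A *m v|.
  have : `|v| <= mxbound Q * `|A *m v| + 1 / 2 * `|v|.
    rewrite -{1}(mul1mx v) -QP mulmxDl -mulmxA (le_trans (ler_normD _ _))// lerD//.
    exact: mulmx_norm_le.
  lra.
have v2 : `|v| ^+ 2 <= (2 * mxbound Q) ^+ 2 * D.
  apply: (@le_trans _ _ ((2 * mxbound Q * `|A *m v|) ^+ 2)).
    by rewrite ler_pXn2r// ?nnegrE// !mulr_ge0// ltW.
  by rewrite exprMn ler_wpM2l ?sqr_ge0// sup_norm_sq_le_dot.
rewrite mulrC ler_pdivrMr; last by rewrite mulr_gt0// exprn_gt0// mulr_gt0.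
apply: (le_trans v2); rewrite mulrC [leRHS]mulrA ler_wpM2r ?sqr_ge0//.
by rewrite mulrC.
Qed.

End DotAlgebra.

(** * First-order expansion of the flow selection *)

Section Selection.
Variables (R : realType) (p d : nat).
Local Notation X := 'cV[R]_p.
Local Notation Y := 'cV[R]_d.
Variables (g : X * Y -> R) (xs : X) (ys : Y).
Let w0 : X * Y := (xs, ys).
Let A := hessyy g w0.
Let B := hessxy g w0.
Hypothesis g1 : Ck 1 g.
Hypothesis G1 : forall j, Ck 1 (fun w => grady g w j 0).
Hypothesis G0 : grady g w0 = 0.
Hypothesis sA : A^T = A.

(** The second-order necessary condition: a direction [v] with <v, A v> < 0 would,
by the mean value theorem, make g strictly decrease along [ys + s *: v]. *)
Lemma local_min_psd : (\forall y' \near ys, g (xs, ys) <= g (xs, y')) ->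
  forall v, 0 <= dot v (A *m v).
Proof.
move=> gmin v; rewrite -oppr_le0.
apply: (@le0_of_small_multiples _ _ (d%:R * (`|v| * `|v|))) => [|e e0]; first by rewrite !mulr_ge0.
have [r r0 rP] := jac_strict_diff w0 G1 e0.
have /nbhs_normP[r' /= r'0 r'P] := gmin.
have v1 : 0 < 1 + `|v| by rewrite ltr_wpDr.
pose t := Num.min r r' / (1 + `|v|).
have m0 : 0 < Num.min r r' by rewrite lt_min r0.
have t0 : 0 < t by rewrite divr_gt0.
have tv s : 0 <= s -> s <= t -> `|s *: v| < Num.min r r'.
  move=> s0 st; rewrite normrZ ger0_norm//.
  apply: (@le_lt_trans _ _ (t * `|v|)); first by rewrite ler_wpM2r.
  rewrite /t -mulrA -[ltRHS]mulr1 ltr_pM2l//.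
  by rewrite mulrC ltr_pdivrMr// mul1r ltrDr.
pose u : X * Y := (0, v).
have uE (s : R) : w0 + s *: u = (xs, ys + s *: v).
  by rewrite [LHS]surjective_pairing /= scaler0 addr0.
pose F (s : R) := g (w0 + s *: u).
have FD (s : R) : is_derive s (1:R) F ('d g (w0 + s *: u) u).
  by apply: is_derive_line; case: g1 => + _; apply.
have [s] : exists2 s, s \in `]0, t[%R & F t - F 0 = 'd g (w0 + s *: u) u * (t - 0).
  apply: (@MVT _ F (fun c => 'd g (w0 + c *: u) u)) => //.
  by apply: derivable_within_continuous => x _; have [] := FD x.
rewrite in_itv/= => /andP[s0 st] FE.
have Fge : 0 <= F t - F 0.
  rewrite subr_ge0 /F !uE scale0r addr0; apply: r'P.
  rewrite /= opprD addrA subrr sub0r normrN.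
  by have := tv t (ltW t0) (lexx t); rewrite lt_min => /andP[].
have dge : 0 <= dot (grady g (w0 + s *: u)) v.
  move: Fge; rewrite FE subr0 pmulr_lge0// diff_gradients; last by case: g1 => + _; apply.
  by rewrite big1 ?add0r// => i _; rewrite /= [X in _ * X]mxE mulr0.
have est : `|grady g (w0 + s *: u) - s *: (A *m v)| <= e * (s * `|v|).
  have sr : `|w0 + s *: u - w0| < r.
    rewrite addrAC subrr add0r normrZ (_ : `|u| = `|v|).
      by have := tv s (ltW s0) (ltW st); rewrite normrZ lt_min => /andP[].
    by rewrite /u pair_normE normr0 max_r.
  have := rP (w0 + s *: u) w0 sr; rewrite subrr normr0 G0 subr0 => /(_ r0).
  have -> : w0 + s *: u - w0 = s *: u by rewrite addrAC subrr add0r.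
  rewrite /jac_map /= scaler0 mulmx0 add0r -/A sA -scalemxAr.
  rewrite normrZ (_ : `|u| = `|v|); last by rewrite /u pair_normE normr0 max_r.
  by rewrite gtr0_norm.
have := dot_norm_le v (grady g (w0 + s *: u) - s *: (A *m v)).
rewrite dotBr dotZr (dotC v (grady _ _)) => h.
have h2 : d%:R * (`|v| * `|grady g (w0 + s *: u) - s *: (A *m v)|)
    <= s * (e * (d%:R * (`|v| * `|v|))).
  apply: (@le_trans _ _ (d%:R * (`|v| * (e * (s * `|v|))))).
    by rewrite ler_wpM2l// ler_wpM2l.
  rewrite le_eqVlt; apply/orP; left; apply/eqP; ring.
have h3 := le_trans (ler_norm _) (le_trans h h2).
have : s * (- dot v (A *m v)) <= s * (e * (d%:R * (`|v| * `|v|))) by lra.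
by rewrite ler_pM2l.
Qed.

Hypothesis psdA : forall v, 0 <= dot v (A *m v).
Variables Q P0 : 'M[R]_d.
Hypothesis QP : Q *m A + P0 = 1%:M.
Hypothesis P0G : forall e : R, 0 < e ->
  exists2 r : R, 0 < r & forall w, `|w - w0| < r ->
    `|P0 *m grady g w| <= e * `|grady g w|.

(** [psd_coercive] applies to the gradient itself, since its [P0] component is
negligible; replacing the Hessian at [w0] by the nearby one costs a small
multiple of |G|^2. *)
Lemma coercive_near :
  exists2 c : R, 0 < c & exists2 r : R, 0 < r & forall w, `|w - w0| < r ->
    c * dot (grady g w) (grady g w) <= dot (grady g w) ((hessyy g w)^T *m grady g w).
Proof.
have [c0 c00 c0P] := psd_coercive sA psdA QP.
have [r1 r10 r1P] := P0G (divr_gt0 ltr01 (ltr0Sn R 1)).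
pose k : R := d%:R + 1.
have k0 : 0 < k by rewrite ltr_wpDl.
have dk : d%:R <= k :> R by rewrite lerDl.
pose eta := c0 / (2 * k ^+ 2).
have eta0 : 0 < eta by rewrite divr_gt0// mulr_gt0// exprn_gt0.
have [_ Hc] := C1_jac_cont G1.
have /nbhs_normP[r2 /= r20 r2P] : \forall w \near w0, `|A - hessyy g w| < eta.
  by have /cvgrPdist_lt := Hc w0; exact.
exists (c0 / 2 / k); first by rewrite !divr_gt0.
exists (Num.min r1 r2) => [|w]; first by rewrite lt_min r10.
rewrite lt_min => /andP[w1 w2].
have := r2P w; rewrite /= distrC => /(_ w2) AH.
set G := grady g w; set H := hessyy g w.
have GA := c0P G (r1P w w1).
have est : `|dot G ((A - H)^T *m G)| <= c0 / 2 * `|G| ^+ 2.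
  rewrite (le_trans (dot_norm_le _ _))//.
  have AHT : `|(A - H)^T| <= eta.
    apply: mx_norm_le => [|i j]; first exact: ltW.
    by rewrite mxE (le_trans (entry_norm_le _ _ _))// ltW.
  apply: (@le_trans _ _ (k * (`|G| * (k * eta * `|G|)))).
    rewrite ler_pM// ?mulr_ge0// ler_wpM2l// (le_trans (mulmx_norm_le_dim _ _))//.
    by rewrite ler_wpM2r// ler_pM.
  rewrite le_eqVlt; apply/orP; left; apply/eqP; rewrite /eta; field.
  by rewrite gt_eqF.
have dotG : dot G G <= k * `|G| ^+ 2.
  rewrite (le_trans (ler_norm _))// (le_trans (dot_norm_le _ _))// -expr2.
  by rewrite ler_wpM2r// sqr_ge0.
have split_dot (u : Y) (M N : 'M[R]_d) :
    dot u (N^T *m u) = dot u (M^T *m u) - dot u ((M - N)^T *m u).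
  by rewrite raddfB/= mulmxBl dotBr opprB addrC subrK.
rewrite (split_dot G A H) sA.
apply: (@le_trans _ _ (c0 / 2 * `|G| ^+ 2)).
  rewrite -[_ / k * _]mulrA ler_wpM2l ?divr_ge0 ?(ltW c00)//.
  by rewrite mulrC ler_pdivrMr// mulrC.
move: est; rewrite ler_norml => /andP[_ est]; lra.
Qed.

Variable flow : R -> X * Y -> Y.
Hypothesis flowP : gradient_flow g flow.

Lemma grady_slice_diff (x : X) (v : Y) :
  differentiable (fun y : Y => grady g (x, y)) v /\
  forall u, 'd (fun y : Y => grady g (x, y)) v u = (hessyy g (x, v))^T *m u.
Proof.
have Gd : differentiable (grady g) (x, v) /\
    forall u, 'd (grady g) (x, v) u = jac_map (grady g) (x, v) u.
  have jlin : linear (jac_map (grady g) (x, v)).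
    by move=> a u u'; rewrite /jac_map/= !mulmxDr -!scalemxAr scalerDr addrACA.
  pose lM := GRing.isLinear.Build _ _ _ _ _ jlin.
  pose J : {linear (X * Y)%type -> Y} := HB.pack (jac_map (grady g) (x, v)) lM.
  have Jc : continuous J.
    move=> u; apply: cvgD.
      by apply: (@cvg_comp _ _ _ fst (mulmx _)); [exact: cvg_fst|exact: mulmx_continuous].
    by apply: (@cvg_comp _ _ _ snd (mulmx _)); [exact: cvg_snd|exact: mulmx_continuous].
  have [//|fd fE] := @expansion_diff _ _ _ (grady g) (x, v) J Jc.
    move=> e e0; have [r r0 rP] := jac_strict_diff (x, v) G1 e0.
    by exists r => // u ur; apply: rP => //; rewrite subrr normr0.
  by split=> // u; rewrite fE.
have pd : is_diff v (fun y : Y => (x, y)) (fun u => (0, u)) by exact: is_diff_pair.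
have [pd1 pd2] := pd.
split; first exact: (@differentiable_comp _ _ _ _ (fun y : Y => (x, y)) (grady g) v pd1 Gd.1).
move=> u; rewrite -[LHS]/('d (grady g \o (fun y : Y => (x, y))) v u).
have /(congr1 (@^~ u)) -> := @diff_comp _ _ _ _ (fun y : Y => (x, y)) (grady g) v pd1 Gd.1.
by rewrite /= pd2 Gd.2 /jac_map/= mulmx0 add0r.
Qed.

(** With [h = x - xs] and [k] the displacement of the flow, |k| = O(|h|),
P0 k = o(h), and B^T h + A k = o(h) because the end point is critical;
then k + Q B^T h = P0 k + Q (B^T h + A k) = o(h). *)
Lemma flow_selection_expansion (e : R) : 0 < e -> exists2 r : R, 0 < r & forall x : X,
  `|x - xs| < r ->
  `|flow_selection flow (x, ys) - ys - (- (Q *m B^T)) *m (x - xs)| <= e * `|x - xs|.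
Proof.
move=> e0.
have [c c0 [rc rc0 cP]] := coercive_near.
have [rL rL0 rLP] := jac_strict_diff w0 G1 (ltr01 : 0 < 1 :> R).
pose k : R := d%:R + 1.
have k0 : 0 < k by rewrite ltr_wpDl.
have dk : d%:R <= k :> R by rewrite lerDl.
pose C1 := mxbound B^T + 1.
have C10 : 0 < C1 by rewrite addr_gt0// mxbound_gt0.
(* |G| <= C1 |h| at the start of the flow, and the factor d + 1 accounts for
   passing from the sup norm to the Euclidean one. *)
pose C2 := k * C1 / c.
have C20 : 0 < C2 by rewrite divr_gt0// mulr_gt0.
(* The displacement is at most C2 |h|: its P0 part is then at most e1 C2 |h|, and
   the remainder of G, later multiplied by Q, at most e1 (1 + C2) |h|. *)
pose e1 := e / (C2 + mxbound Q * (1 + C2)).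
have den0 : 0 < C2 + mxbound Q * (1 + C2) by rewrite addr_gt0// mulr_gt0 ?mxbound_gt0// addr_gt0.
have e10 : 0 < e1 by rewrite divr_gt0.
have [rP rP0 rPP] := P0G e10.
have [rS rS0 rSP] := jac_strict_diff w0 G1 e10.
pose delta := Num.min (Num.min rc rL) (Num.min rP rS).
have delta0 : 0 < delta by rewrite !lt_min rc0 rL0 rP0.
have wd (w : X * Y) : `|w - w0| < delta ->
    [/\ `|w - w0| < rc, `|w - w0| < rL, `|w - w0| < rP & `|w - w0| < rS].
  by rewrite !lt_min => /andP[/andP[-> ->] /andP[-> ->]].
exists (Num.min delta (delta / C2)); first by rewrite lt_min delta0 divr_gt0.
move=> x; rewrite lt_min => /andP[xd xC].
set h := x - xs in xd xC *.
have hC : C2 * `|h| < delta by rewrite mulrC -ltr_pdivlMr.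
have xv (v : Y) : `|v - ys| < delta -> `|(x, v) - w0| < delta.
  by move=> vd; rewrite (_ : (x, v) - w0 = (h, v - ys))// pair_normE gt_max xd.
have ysd : `|ys - ys| < delta by rewrite subrr normr0.
pose G (v : Y) := grady g (x, v).
have G00 : `|G ys| <= C1 * `|h|.
  have [_ wL _ _] := wd _ (xv ys ysd).
  have := rLP (x, ys) w0 wL; rewrite subrr normr0 => /(_ rL0).
  rewrite G0 subr0 (_ : (x, ys) - w0 = (h, 0)); last first.
    by rewrite [LHS]surjective_pairing /= subrr.
  rewrite /jac_map /= mulmx0 addr0 pair_normE normr0 max_l// mul1r => est.
  rewrite -[G ys](subrK (B^T *m h)) (le_trans (ler_normD _ _))// /C1 mulrDl mul1r addrC.
  by rewrite lerD// mulmx_norm_le.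
have [fl0 flc fld] := flowP x ys.
pose y (t : R) := flow t (x, ys).
have Gd v : differentiable G v by have [] := grady_slice_diff x v.
have y0 : y 0 = ys by [].
have Gc v : `|v - y 0| < delta -> c * dot (G v) (G v) <= dot (G v) ('d G v (G v)).
  rewrite y0 => /xv /wd[wc _ _ _]; have [_ ->] := grady_slice_diff x v.
  exact: cP.
have SC : Num.sqrt (dot (G (y 0)) (G (y 0))) / c <= C2 * `|h|.
  rewrite ler_pdivrMr// /C2 mulrAC divfK ?gt_eqF// y0.
  apply: (@le_trans _ _ (k * `|G ys|)); last by rewrite -mulrA ler_wpM2l// ltW.
  rewrite -(ler_pXn2r (ltn0Sn 1)) ?nnegrE ?sqrtr_ge0//; last by rewrite mulr_ge0// ltW.
  rewrite sqr_sqrtr ?dot_ge0// exprMn (le_trans (ler_norm _))// (le_trans (dot_norm_le _ _))// -expr2.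
  rewrite ler_wpM2r ?sqr_ge0// (le_trans dk)// expr2 ler_pMr// /k lerDr.
  by rewrite ler0n.
have Sd := le_lt_trans SC hC.
have [yinf [ylim Ginf yK yP]] := @flow_limit _ _ G y Gd flc fld c delta c0 Gc Sd.
have -> : flow_selection flow (x, ys) = yinf by exact: cvg_lim.
rewrite y0 in yK yP SC.
have kC : `|yinf - ys| <= C2 * `|h| by exact: le_trans yK SC.
have P0k : `|P0 *m (yinf - ys)| <= e1 * (C2 * `|h|).
  apply: le_trans (yP P0 e1 (ltW e10) _) _.
    by move=> v /xv /wd[_ _ wP _]; exact: rPP.
  by rewrite -mulrA ler_wpM2l// ltW.
have Ak : `|B^T *m h + A *m (yinf - ys)| <= e1 * ((1 + C2) * `|h|).
  have [_ _ _ wS] := wd _ (xv yinf (le_lt_trans kC hC)).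
  have := rSP (x, yinf) w0 wS; rewrite subrr normr0 => /(_ rS0).
  rewrite G0 subr0 (_ : (x, yinf) - w0 = (h, yinf - ys))//.
  rewrite -[grady g _]/(G yinf) Ginf sub0r normrN /jac_map /= -/A sA => est.
  apply: (le_trans est); rewrite ler_wpM2l ?(ltW e10)// pair_normE mulrDl mul1r ge_max.
  by rewrite lerDl mulr_ge0 ?(ltW C20)//= (le_trans kC)// lerDr.
have -> : yinf - ys - - (Q *m B^T) *m h =
    P0 *m (yinf - ys) + Q *m (B^T *m h + A *m (yinf - ys)).
  have P0E : P0 *m (yinf - ys) = (yinf - ys) - Q *m A *m (yinf - ys).
    by rewrite -{2}[yinf - ys]mul1mx -QP mulmxDl addrAC subrr add0r.
  by rewrite mulNmx opprK mulmxDr !mulmxA P0E addrA addrAC subrK.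
rewrite (le_trans (ler_normD _ _))//.
apply: (le_trans (lerD P0k (mulmx_norm_le _ _))).
apply: (@le_trans _ _ (e1 * (C2 * `|h|) + mxbound Q * (e1 * ((1 + C2) * `|h|)))).
  by rewrite lerD2l ler_wpM2l// ltW// mxbound_gt0.
rewrite le_eqVlt; apply/orP; left; apply/eqP; rewrite /e1; field.
by rewrite gt_eqF.
Qed.

End Selection.

(** * Limits of the algorithm *)

Section Limit.
Variables (R : realType) (p d : nat).
Local Notation X := 'cV[R]_p.
Local Notation Y := 'cV[R]_d.

Lemma cvg_pair_at (T : Type) (F : set_system T) {FF : Filter F} (V W : normedModType R)
    (f : T -> V) (h : T -> W) (a : V) (b : W) :
  f t @[t --> F] --> a -> h t @[t --> F] --> b -> (f t, h t) @[t --> F] --> (a, b).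
Proof. by move=> fa hb; exact: (cvg_pair fa hb). Qed.

Lemma grady_C1 (k : nat) (g : X * Y -> R) :
  Ck k.+2 g -> forall j, Ck 1 (fun w => grady g w j 0).
Proof.
move=> [_ gk] j.
rewrite (_ : (fun w => grady g w j 0) = 'D_((0 : X), (delta_mx j 0 : Y)) g).
  exact: Ck_C1 (gk _).
by apply/funext => w; rewrite mxE.
Qed.

Lemma hessyy_sym (g : X * Y -> R) w : Ck 2 g -> (hessyy g w)^T = hessyy g w.
Proof.
move=> g2; apply/matrixP => i j; rewrite !mxE.
have E k : (fun w' => grady g w' k 0) = 'D_((0 : X), (delta_mx k 0 : Y)) g.
  by apply/funext => w'; rewrite mxE.
by rewrite !E; apply: second_derivative_comm => //; exact: frame_XY.
Qed.

Lemma seq_limit_unique (V : normedModType R) (u : nat -> V) (a b : V) :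
  u k @[k --> \oo] --> a -> u k @[k --> \oo] --> b -> a = b.
Proof. by move=> ua ub; exact: (cvg_unique _ ua ub). Qed.

(** Each line of the recursion is continuous; the least-squares map is only known to
be continuous along symmetric matrices, which is where the symmetry of the
Hessians of all iterates enters. *)
Lemma bgs_limit (f g : X * Y -> R) (IM phi : X * Y -> Y) (P : 'M[R]_d * Y * Y -> Y)
  (gamma : R) (x : nat -> X) (y z : nat -> Y) (xs : X) (ys zs : Y) :
  Ck 1 f -> Ck 2 g -> continuous IM -> Ck 1 phi ->
  {within [set a : 'M[R]_d * Y * Y | a.1.1^T = a.1.1], continuous P} ->
  0 < gamma -> bgs_opt f g IM phi P gamma x y z ->
  x k @[k --> \oo] --> xs -> y k @[k --> \oo] --> ys -> z k @[k --> \oo] --> zs ->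
  let w1 := (xs, IM (xs, ys)) in
  [/\ ys = phi w1,
      zs = P (hessyy g (xs, ys), grady (composed f phi) w1, zs) &
      gradx (composed f phi) w1 + hessxy g (xs, ys) *m (hessyy g (xs, ys) *m zs) = 0].
Proof.
move=> f1 g2 IMc phi1 Pc gamma0 bgs xc yc zc w1.
have G1 := grady_C1 g2.
have [hxc hyc] := C1_jac_cont G1.
have phij j : Ck 1 (fun w => phi w j 0) by apply: Ck1_coord => //; exact: openT.
have [jxc jyc] := C1_jac_cont phij.
have [gxc gyc] := C1_grad_cont f1.
have phic : continuous phi by move=> w; exact: (Ck_cont phi1 (I : setT w)).
have pairc : continuous (fun w : X * Y => (w.1, phi w)).
  by move=> w; apply: (@cvg_pair_at _ (nbhs w)); [exact: cvg_fst|exact: phic].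
have fd w : differentiable f w by case: f1 => + _; apply.
have phid w : differentiable phi w by case: phi1 => + _; apply.
have cxc : continuous (gradx (composed f phi)).
  rewrite (_ : gradx _ = fun w =>
    gradx f (w.1, phi w) + jacx phi w *m grady f (w.1, phi w)); last first.
    by apply/funext => w; have [] := gradient_composed (fd (w.1, phi w)) (phid w).
  move=> w; apply: cvgD.
    exact: (@cvg_comp _ _ _ (fun w : X * Y => (w.1, phi w)) (gradx f) _ _ _ (pairc w) (gxc _)).
  apply: (@cvg_mulmx _ _ (nbhs w)); first exact: jxc.
  exact: (@cvg_comp _ _ _ (fun w : X * Y => (w.1, phi w)) (grady f) _ _ _ (pairc w) (gyc _)).
have cyc : continuous (grady (composed f phi)).
  rewrite (_ : grady _ = fun w => jacy phi w *m grady f (w.1, phi w)); last first.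
    by apply/funext => w; have [] := gradient_composed (fd (w.1, phi w)) (phid w).
  move=> w; apply: (@cvg_mulmx _ _ (nbhs w)); first exact: jyc.
  exact: (@cvg_comp _ _ _ (fun w : X * Y => (w.1, phi w)) (grady f) _ _ _ (pairc w) (gyc _)).
have shift (V : normedModType R) (u : nat -> V) (l : V) :
    u k @[k --> \oo] --> l -> u k.+1 @[k --> \oo] --> l.
  by move=> ul; rewrite cvg_shiftS.
have seqc (V W : normedModType R) (F : V -> W) (u : nat -> V) l : continuous F ->
    u k @[k --> \oo] --> l -> F (u k) @[k --> \oo] --> F l.
  by move=> Fc ul; exact: (@cvg_comp _ _ _ u F _ _ _ ul (Fc l)).
have xy : (x k, y k) @[k --> \oo] --> (xs, ys) by exact: cvg_pair_at.
have xyt : (x k, IM (x k, y k)) @[k --> \oo] --> w1 by apply: cvg_pair_at => //; exact: seqc.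
have y1 := shift _ _ _ yc.
have xy1 : (x k, y k.+1) @[k --> \oo] --> (xs, ys) by exact: cvg_pair_at.
have z1 := shift _ _ _ zc.
have x1 := shift _ _ _ xc.
split.
- apply: (seq_limit_unique y1).
  rewrite (_ : (fun k => y k.+1) = fun k => phi (x k, IM (x k, y k))); first exact: seqc.
  by apply/funext => k; have [] := bgs k.
- apply: (seq_limit_unique z1).
  rewrite (_ : (fun k => z k.+1) = fun k => P (hessyy g (x k, y k.+1),
    grady (composed f phi) (x k, IM (x k, y k)), z k)); last first.
    by apply/funext => k; have [] := bgs k.
  have argc : (hessyy g (x k, y k.+1),
      grady (composed f phi) (x k, IM (x k, y k)), z k) @[k --> \oo]
     --> (hessyy g (xs, ys), grady (composed f phi) w1, zs).
    by apply: cvg_pair_at => //; apply: cvg_pair_at; exact: seqc.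
  move/subspace_continuousP: Pc =>
    /(_ (hessyy g (xs, ys), grady (composed f phi) w1, zs) (hessyy_sym _ g2)) Pc.
  pose u k := (hessyy g (x k, y k.+1), grady (composed f phi) (x k, IM (x k, y k)), z k).
  apply: (@cvg_comp _ _ _ u P _ _ _ _ Pc) => C SC.
  suff : \forall k \near \oo, C (u k) by [].
  have : \forall k \near \oo, (u k).1.1^T = (u k).1.1 -> C (u k) by exact: (argc _ SC).
  by apply: filterS => k; apply; exact: hessyy_sym.
- have dk : gradx (composed f phi) (x k, IM (x k, y k)) +
     hessxy g (x k, y k.+1) *m (hessyy g (x k, y k.+1) *m z k.+1) @[k --> \oo] -->
     gradx (composed f phi) w1 + hessxy g (xs, ys) *m (hessyy g (xs, ys) *m zs).
    apply: cvgD; first exact: seqc.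
    apply: cvg_mulmx; first exact: seqc.
    by apply: cvg_mulmx => //; exact: seqc.
  apply: (seq_limit_unique dk).
  rewrite (_ : (fun k => _) = fun k => gamma^-1 *: (x k - x k.+1)); last first.
    apply/funext => k; have [_ _ ->] := bgs k.
    have subKl (a b : X) : a - (a - b) = b by rewrite opprB addrC subrK.
    by rewrite subKl scalerA mulVf ?scale1r// gt_eqF.
  rewrite -(scaler0 _ gamma^-1) -(subrr xs); apply: cvgZl_tmp; exact: cvgB.
Qed.

(** With [eta = D fy + A z] the two hypotheses read A (A eta + fy) = 0 and
fx + B eta = 0. Since [Q *m A] is symmetric and [B = E *m A],
B Q^T fy = E Q A fy = - E Q A A eta = - B eta. *)
Lemma stationarity_algebra (A D Q : 'M[R]_d) (B E : 'M[R]_(p, d)) (z fy : Y) (fx : X) :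
  A^T = A -> A = Q *m A *m A -> B = E *m A ->
  A *m (A *m A *m z + (1%:M + A *m D) *m fy) = 0 ->
  fx + B *m D *m fy + B *m (A *m z) = 0 ->
  fx - B *m Q^T *m fy = 0.
Proof.
move=> sA AQ BE LS dz.
have QAs : (Q *m A)^T = Q *m A.
  have H : (Q *m A)^T = (Q *m A) *m (Q *m A)^T.
    by rewrite trmx_mul sA !mulmxA -AQ.
  move: H; move: (Q *m A) => S H.
  by rewrite -[RHS]trmxK [in RHS]H trmx_mul trmxK -H.
pose eta := D *m fy + A *m z.
have e1 : fx + B *m eta = 0 by rewrite /eta mulmxDr addrA !mulmxA in dz *.
have e2 : A *m fy = - (A *m (A *m eta)).
  apply/eqP; rewrite -subr_eq0 opprK -LS /eta mulmxDl mul1mx !mulmxDr !mulmxA.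
  apply/eqP; rewrite addrC -addrA addrC addrA [_ + A *m fy]addrC -!addrA.
  by congr (_ + _); rewrite addrC.
have -> : B *m Q^T *m fy = - (B *m eta).
  rewrite BE -(mulmxA E A) (_ : A *m Q^T = Q *m A); last by rewrite -QAs trmx_mul sA.
  have QAA : Q *m (A *m (A *m eta)) = A *m eta by rewrite !mulmxA -AQ.
  by rewrite -!mulmxA e2 !mulmxN QAA.
by rewrite opprK.
Qed.

End Limit.

Theorem proposition5 (R : realType) (p d : nat) (p_gt0 : (0 < p)%N)
  (d_gt0 : (0 < d)%N)
  (f g : 'cV[R]_p * 'cV[R]_d -> R)
  (f_C1 : Ck 1 f) (g_C3 : Ck 3 g)
  (g_MB : parametric_Morse_Bott g)
  (g_Lip : exists2 L : R, 0 < L &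
     forall (x : 'cV[R]_p) (y y' : 'cV[R]_d),
       enorm (grady g (x, y) - grady g (x, y')) <= L * enorm (y - y'))
  (g_coercive : forall (x : 'cV[R]_p) (B : R), exists r : R,
     forall y : 'cV[R]_d, r < enorm y -> B < g (x, y))
  (flow : R -> 'cV[R]_p * 'cV[R]_d -> 'cV[R]_d)
  (flowP : gradient_flow g flow)
  (I phiT : nat -> 'cV[R]_p * 'cV[R]_d -> 'cV[R]_d)
  (I_phiT_A : assumption_A g I phiT)
  (P : 'M[R]_d * 'cV[R]_d * 'cV[R]_d -> 'cV[R]_d)
  (P_ls : least_squares_map P)
  (M T : nat) (TM_gt0 : (0 < T + M)%N)
  (gamma : R) (gamma_gt0 : 0 < gamma)
  (x : nat -> 'cV[R]_p) (y z : nat -> 'cV[R]_d)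
  (xyz_bgs : bgs_opt f g (I M) (phiT T) P gamma x y z)
  (xs : 'cV[R]_p) (ys zs : 'cV[R]_d)
  (x_cvg : x k @[k --> \oo] --> xs)
  (y_cvg : y k @[k --> \oo] --> ys)
  (z_cvg : z k @[k --> \oo] --> zs) :
  let L_phi := composed f (flow_selection flow) in
  grady g (xs, ys) = 0 /\
  ((\forall y' \near ys, g (xs, ys) <= g (xs, y')) ->
   [/\ differentiable (fun x' : 'cV[R]_p => L_phi (x', ys)) xs,
       gradx L_phi (xs, ys) = 0 &
       grady g (xs, ys) = 0]).
Proof.
move=> L_phi.
have g_C2 := Ck_pred g_C3.
have g_C1 := Ck_C1 g_C2.
have G1 := grady_C1 g_C2.
have [Ic phi1 _ phiD crit] := I_phiT_A.
have [P_cont P_fix] := P_ls.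
have [ysE zsE dE] := bgs_limit f_C1 g_C2 (Ic M) (phi1 T) P_cont
  gamma_gt0 xyz_bgs x_cvg y_cvg z_cvg.
have G0 : grady g (xs, ys) = 0 by exact: crit ysE.
split=> // ys_min.
have [D [IE phiE jxE jyE]] := phiD xs ys G0 M T.
rewrite IE in zsE dE.
set w0 := (xs, ys) in zsE dE jxE jyE G0 *.
set A := hessyy g w0 in zsE dE jyE; set B := hessxy g w0 in dE jxE.
have sA : A^T = A by exact: hessyy_sym.
have fd w : differentiable f w by case: f_C1 => + _; apply.
have phid : differentiable (phiT T) w0 by case: (phi1 T) => + _; apply.
have [cxE cyE] := gradient_composed (fd (w0.1, phiT T w0)) phid.
rewrite phiE jyE /= in cyE; rewrite phiE jxE /= in cxE.
rewrite cyE in zsE; rewrite cxE in dE.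
have LS := least_squares_normal sA (P_fix _ _ _ sA zsE).
have [Q AQ] := sym_factor_sq sA.
have [/submxP[E BE] MB] := morse_bott_local G1 g_MB G0.
have psdA := local_min_psd g_C1 G1 G0 sA ys_min.
pose P0 := 1%:M - Q *m A.
have QP : Q *m A + P0 = 1%:M by rewrite /P0 addrC subrK.
have P0A : P0 *m A^T = 0 by rewrite sA /P0 mulmxBl mul1mx -AQ subrr.
have expansion := flow_selection_expansion G1 G0 sA psdA QP (MB P0 P0A) flowP.
have selE : flow_selection flow w0 = ys.
  have [r r0 rP] := expansion 1 ltr01.
  have := rP xs; rewrite subrr normr0 mulmx0 subr0 mulr0 => /(_ r0).
  by rewrite normr_le0 subr_eq0 => /eqP.
pose J : 'M[R]_(d, p) := - (Q *m B^T).
have Jc : continuous (mulmx J : 'cV[R]_p -> 'cV[R]_d) by exact: mulmx_continuous.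
have [|seld selD] := @expansion_diff _ _ _ (fun x' => flow_selection flow (x', ys)) xs (mulmx J) Jc.
  move=> e e0; have [r r0 rP] := expansion e e0; exists r => // u ur.
  by rewrite -/w0 selE; exact: rP.
have idd : differentiable (@id 'cV[R]_p) xs by [].
have pd : differentiable (fun x' : 'cV[R]_p => (x', flow_selection flow (x', ys))) xs.
  exact: (differentiable_pair idd seld).
have fd0 : differentiable f (xs, flow_selection flow (xs, ys)) by exact: fd.
have Ld : differentiable (fun x' => L_phi (x', ys)) xs by exact: (differentiable_comp pd fd0).
split=> //.
have gradE : gradx L_phi w0 = gradx f w0 - B *m Q^T *m grady f w0.
  apply/colP => i; rewrite mxE.
  have -> : 'D_((delta_mx i 0 : 'cV[R]_p), (0 : 'cV[R]_d)) L_phi w0 =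
     'D_(delta_mx i 0) (fun x' => L_phi (x', ys)) xs.
    rewrite /derive; set q1 := (X in lim (X @ _)); set q2 := (X in _ = lim (X @ _)).
    suff -> : q1 = q2 by [].
    apply/funext => h; rewrite /q1 /q2 /=.
    rewrite (_ : h *: _ + w0 = (h *: delta_mx i 0 + xs, ys))//.
    by rewrite [LHS]surjective_pairing /= scaler0 add0r.
  rewrite deriveE//.
  rewrite -[LHS]/('d (f \o (fun x' : 'cV[R]_p =>
    (x', flow_selection flow (x', ys)))) xs (delta_mx i 0)).
  have /(congr1 (@^~ (delta_mx i 0))) -> := diff_comp pd fd0.
  have /(congr1 (@^~ (delta_mx i 0))) E2 := diff_pair idd seld.
  rewrite /= E2 -/w0 selE selD diff_val diff_gradients// [RHS]mxE /=; congr (_ + _).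
    rewrite (bigD1 i)//= [X in _ * X]mxE !eqxx mulr1 big1 ?addr0// => k ki.
    by rewrite [X in _ * X]mxE (negPf ki) mulr0.
  have JE j : (J *m (delta_mx i 0 : 'cV[R]_p)) j 0 = - (B *m Q^T) i j.
    by rewrite -colE mxE /J mxE -[Q in LHS]trmxK -trmx_mul mxE.
  rewrite [RHS]mxE [X in - X]mxE -sumrN; apply: eq_bigr => j _.
  by rewrite JE mulrC mulNr.
rewrite gradE; apply: (stationarity_algebra sA AQ BE LS); rewrite -dE.
by rewrite !mulmxA.
Qed.
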